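(* Let $d,l\in\mathbb N^*$. For any $r\in\mathbb N$ and $\mathbf t=(t_1,\dots,t_l)\in(\mathbb N^* )^l$, the class of functions $\overline\Gamma^M_{(\mathbf t,r)}$ is VC-subgraph on $[0,1]^d$ with dimension $$V^M_{(\mathbf t,r)}\le2+\left[2ld+\left(\prod_{j=1}^lt_j\right)(r+1)^l\right]\log_2\left[4eU\log_2(2eU)\right],$$ where $U=\sum_{j=1}^lt_j+lr+l+1$.
   Context: For $\mathbf t\in(\mathbb N^* )^l$, partition $[0,1]^l$ into the $\prod_jt_j$ hyperrectangles $\prod_{j=1}^lI_j'(h_j)$, $h_j\in\{0,\dots,t_j-1\}$, with $I_j'(0)=[0,1/t_j]$ and $I_j'(h)=(h/t_j,(h+1)/t_j]$ for $h\ge1$. $\overline S^{\mathcal H,l}_{(\mathbf t,r)}$ is the space of functions on $[0,1]^l$ whose restriction to each hyperrectangle is a polynomial in $l$ variables of degree at most $r$ in each variable. Fix real numbers $v_-<v_+$ and let $\overline\Gamma^{\mathcal H,l}_{(\mathbf t,r)}=\{(\gamma\vee v_-)\wedge v_+:\gamma\in\overline S^{\mathcal H,l}_{(\mathbf t,r)}\}$. Let $\mathcal C_d=\{c\in\mathbb R^d:\sum_{j=1}^d|c_j|\le1\}$. Then $$\overline\Gamma^M_{(\mathbf t,r)}=\left\{f(g_1(\cdot),\dots,g_l(\cdot)):f\in\overline\Gamma^{\mathcal H,l}_{(\mathbf t,r)},\ g_j=\tfrac12[\langle a_j,\cdot\rangle+1],\ a_j\in\mathcal C_d,\ j=1,\dots,l\right\},$$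 a class of functions on $[0,1]^d$. A class $\mathcal F$ of real functions on a set $\mathscr W$ is VC-subgraph with dimension $V$ if $V$ is the largest cardinality of a finite set $\mathcal S\subset\mathscr W\times\mathbb R$ all of whose subsets are of the form $\mathcal S\cap\{(w,y):y<f(w)\}$ with $f\in\mathcal F$. *)

(* Defs.v *)
From HB Require Import structures.
From mathcomp Require Import all_boot all_order all_algebra.
From mathcomp Require Import all_classical all_reals all_analysis.
(* [mpoly] is not imported because its notations clash with those of
   MathComp-Analysis. *)
From mathcomp Require mpoly.

Set Implicit Arguments.
Unset Strict Implicit.
Unset Printing Implicit Defensive.

Import Order.TTheory GRing.Theory Num.Theory.

Local Open Scope classical_set_scope.
Local Open Scope ring_scope.
Local Open Scope card_scope.

(* Throughout, a function on [0,1]^n is represented by a total function on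
   'rV[R]_n. Its values outside the cube are unconstrained junk: they play no
   role below, since splines are only constrained on the cells, the maps
   [ridge a] with a in the l1-ball send the cube into the cube, and shattering
   is relative to the domain [W]. *)

Definition unit_cube (R : realType) (n : nat) : set 'rV[R]_n :=
  [set x | forall j, `[0, 1]%classic (x 0 j)].
Arguments unit_cube : clear implicits.

Definition cell_interval (R : realType) (t h : nat) : set R :=
  if h == 0%N then `[0, t%:R^-1]%classic
  else `]h%:R / t%:R, h.+1%:R / t%:R]%classic.
Arguments cell_interval : clear implicits.

Definition hyperrectangle (R : realType) (l : nat) (t : 'I_l -> nat)
    (h : forall j : 'I_l, 'I_(t j)) : set 'rV[R]_l :=
  [set x | forall j, cell_interval R (t j) (h j) (x 0 j)].
Arguments hyperrectangle R {l} t h.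

Definition degree_each_le (R : realType) (l r : nat)
    (p : mpoly.mpoly l R) : Prop :=
  forall m, mpoly.mcoeff m p != 0 ->
    forall j : 'I_l, (mpoly.fun_of_multinom m j <= r)%N.

Definition spline (R : realType) (l : nat) (t : 'I_l -> nat) (r : nat) :
    set ('rV[R]_l -> R) :=
  [set gamma | forall h : (forall j : 'I_l, 'I_(t j)),
    exists2 p : mpoly.mpoly l R, degree_each_le r p &
      forall x, hyperrectangle R t h x ->
        gamma x = mpoly.meval (fun j => x 0 j) p].
Arguments spline R {l} t r.

Definition clipped_spline (R : realType) (vm vp : R) (l : nat)
    (t : 'I_l -> nat) (r : nat) : set ('rV[R]_l -> R) :=
  [set (fun x => Num.min (Num.max (gamma x) vm) vp) | gamma in spline R t r].

Definition l1_ball (R : realType) (d : nat) : set 'rV[R]_d :=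
  [set c | \sum_(j < d) `|c 0 j| <= 1].
Arguments l1_ball : clear implicits.

Definition dotv (R : realType) (d : nat) (a x : 'rV[R]_d) : R :=
  \sum_(i < d) a 0 i * x 0 i.

(* x |-> (g_1(x), ..., g_l(x)) with g_j(x) = (<a_j, x> + 1) / 2. *)
Definition ridge (R : realType) (d l : nat) (a : 'I_l -> 'rV[R]_d)
    (x : 'rV[R]_d) : 'rV[R]_l :=
  \row_(j < l) (2^-1 * (dotv (a j) x + 1)).

Definition GammaM (R : realType) (vm vp : R) (d l : nat)
    (t : 'I_l -> nat) (r : nat) : set ('rV[R]_d -> R) :=
  [set phi | exists2 f, clipped_spline vm vp t r f &
    exists2 a : 'I_l -> 'rV[R]_d, (forall j, l1_ball R d (a j)) &
      phi = (fun x => f (ridge a x))].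
Arguments GammaM {R} vm vp d {l} t r.

Definition subgraph_shatters (R : realType) (T : Type) (F : set (T -> R))
    (S : set (T * R)) : Prop :=
  forall A : set (T * R), A `<=` S ->
    exists2 f, F f & A = S `&` [set p | p.2 < f p.1].

Definition VC_subgraph_dim (R : realType) (T : Type) (W : set T)
    (F : set (T -> R)) (V : nat) : Prop :=
  (exists S : set (T * R),
     [/\ S `<=` W `*` setT, S #= `I_V & subgraph_shatters F S]) /\
  (forall (n : nat) (S : set (T * R)),
     S `<=` W `*` setT -> S #= `I_n -> subgraph_shatters F S -> (n <= V)%N).

Definition log2 (R : realType) (x : R) : R := ln x / ln 2.

(* Main.v *)
(* Fix a shattered set of m points (x_i, y_i). Since the traces vary with y_i on
   both sides of the graph, v_- <= y_i < v_+, so the truncation plays no role.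
   The parameters are the vectors a_j and the coefficients of all the pieces.
   The signs of the affine functions g_j(x_i) - h/t_j of the a_j determine the
   cell that contains each (g_1(x_i), ..., g_l(x_i)); once these signs are fixed,
   f(g(x_i)) - y_i is a polynomial of degree at most lr+1 in the parameters.
   Hence 2^m is at most a number of sign patterns of m sum_j t_j affine functions
   in ld variables, times a number of sign patterns of m polynomials of degree
   D = lr+1 in n = ld + (prod_j t_j)(r+1)^l variables.

   The sign patterns are counted by a Warren-type bound with an elementary
   proof. Each realised pattern is represented by a minimiser w of
   sum_t x_t^(2k+2) plus a large multiple of the squares of those p_i that have
   the wrong sign. After a generic shift of the p_i, at most n of them have the
   wrong sign at w; these i form a set A, and (A, w) determines the pattern. The
   points w with a given A are critical points of one polynomial. For k = D its
   leading form is sum_t x_t^(2D+2), so its gradient equations reduce all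
   monomials to exponents at most 2D, and there are at most (2D+1)^n such w; for
   affine p_i and k = 0, strict convexity leaves only one. This gives the bounds
   (2D+1)^n sum_(j <= n) C(m, j) and, for affine p_i, sum_(j <= n) C(m, j). *)
Require Import Defs.
From mathcomp Require Import all_boot all_order all_algebra.
From mathcomp Require Import all_classical all_reals all_analysis.
From mathcomp Require Import ring lra zify.
From mathcomp Require mpoly.
Import Order.TTheory GRing.Theory Num.Theory.
Import numFieldNormedType.Exports.
Local Open Scope classical_set_scope.
Local Open Scope ring_scope.

Set Implicit Arguments.
Unset Strict Implicit.
Unset Printing Implicit Defensive.

(** * Polynomial functions *)

(** Polynomials are handled as functions; [D] is only an upper bound on the total degree. Peeling
    off one variable at a time suits the reduction of monomials and differentiation. *)
Inductive polyfun (R : comNzRingType) (T : Type) :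
    nat -> ((T -> R) -> R) -> Prop :=
| polyfun_cst D c : polyfun D (fun=> c)
| polyfunD D f g :
    polyfun D f -> polyfun D g -> polyfun D (fun x => f x + g x)
| polyfunXM D j f : polyfun D f -> polyfun D.+1 (fun x => x j * f x).

Lemma polyfun_leq (R : comNzRingType) (T : Type) D E (f : (T -> R) -> R) :
  (D <= E)%N -> polyfun D f -> polyfun E f.
Proof.
move=> leDE pf; elim: pf E leDE => {D f}.
- by move=> *; exact: polyfun_cst.
- by move=> D f g _ IHf _ IHg E leDE; apply: polyfunD; [exact: IHf|exact: IHg].
- by move=> D j f _ IHf [//|E] leDE; apply: polyfunXM; exact: IHf.
Qed.

Lemma polyfunZ (R : comNzRingType) (T : Type) D c (f : (T -> R) -> R) :
  polyfun D f -> polyfun D (fun x => c * f x).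
Proof.
elim=> {D f}.
- by move=> D c'; exact: polyfun_cst.
- move=> D f g _ IHf _ IHg.
  by under eq_fun do rewrite mulrDr; exact: polyfunD.
- move=> D j f _ IHf.
  by under eq_fun do rewrite mulrCA; exact: polyfunXM.
Qed.

Lemma polyfunM (R : comNzRingType) (T : Type) D E (f g : (T -> R) -> R) :
  polyfun D f -> polyfun E g -> polyfun (D + E) (fun x => f x * g x).
Proof.
move=> pf pg; elim: pf => {D f}.
- by move=> D c; apply/polyfunZ/(polyfun_leq _ pg)/leq_addl.
- move=> D f1 f2 _ IH1 _ IH2.
  by under eq_fun do rewrite mulrDl; exact: polyfunD.
- move=> D j f _ IHf; rewrite addSn.
  by under eq_fun do rewrite -mulrA; exact: polyfunXM.
Qed.

Lemma polyfunX (R : comNzRingType) (T : Type) j :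
  polyfun 1 (fun x : T -> R => x j).
Proof.
have -> : (fun x : T -> R => x j) = fun x => x j * 1.
  by apply: funext => x; rewrite mulr1.
exact/polyfunXM/polyfun_cst.
Qed.

Lemma polyfunXn (R : comNzRingType) (T : Type) D k (f : (T -> R) -> R) :
  polyfun D f -> polyfun (k * D) (fun x => f x ^+ k).
Proof.
move=> pf; elim: k => [|k IHk].
  by under eq_fun do rewrite expr0; exact: polyfun_cst.
by under eq_fun do rewrite exprS; rewrite mulSn; exact: polyfunM.
Qed.

Lemma polyfun_sum (R : comNzRingType) (T : Type) D (I : Type) (s : seq I)
    (P : pred I) (f : I -> (T -> R) -> R) :
  (forall i, P i -> polyfun D (f i)) ->
  polyfun D (fun x => \sum_(i <- s | P i) f i x).
Proof.
move=> pf; elim: s => [|i s IHs].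
  by under eq_fun do rewrite big_nil; exact: polyfun_cst.
case Pi: (P i); under eq_fun do rewrite big_cons Pi.
  by apply: polyfunD => //; exact: pf.
exact: IHs.
Qed.

Lemma polyfun_prod (R : comNzRingType) (T : Type) (I : Type) (s : seq I)
    (P : pred I) (D : I -> nat) (f : I -> (T -> R) -> R) :
  (forall i, P i -> polyfun (D i) (f i)) ->
  polyfun (\sum_(i <- s | P i) D i) (fun x => \prod_(i <- s | P i) f i x).
Proof.
move=> pf; elim: s => [|i s IHs].
  by rewrite big_nil; under eq_fun do rewrite big_nil; exact: polyfun_cst.
rewrite big_cons; set k := (\sum_(j <- s | P j) D j)%N in IHs *.
case Pi: (P i); under eq_fun do rewrite big_cons Pi.
  by apply: polyfunM => //; exact: pf.
exact: IHs.
Qed.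

Lemma polyfun_monomial (R : comNzRingType) (T : finType) (a : T -> nat) :
  polyfun (\sum_j a j) (fun x : T -> R => \prod_j x j ^+ a j).
Proof.
apply: polyfun_prod => j _.
by rewrite -[X in polyfun X]muln1; apply: polyfunXn; exact: polyfunX.
Qed.

(* The relations [w a j ^+ E = g (w a)] with [g] of degree less than [E] allow
   any monomial to be rewritten with all its exponents less than [E], without
   increasing its total degree; they are not needed when [D < E]. *)
Lemma polyfun_reduce (R : comNzRingType) (T : finType) (A : Type)
    (w : A -> T -> R) (E D : nat) (f : (T -> R) -> R) :
  (0 < E)%N ->
  ((E <= D)%N -> forall j, exists2 g, polyfun E.-1 g &
     forall a, w a j ^+ E = g (w a)) ->
  polyfun D f ->
  exists c : {ffun T -> 'I_E} -> R,
    forall a, f (w a) = \sum_m c m * \prod_j w a j ^+ m j.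
Proof.
move=> E_gt0.
(* The span of the monomials with exponents below [E] and total degree at most [k]. Keeping track of
   [k] makes the induction hypothesis available after a substitution. *)
pose spn k (h : A -> R) := exists2 c : {ffun T -> 'I_E} -> R,
  (forall m : {ffun T -> 'I_E}, (k < \sum_j m j)%N -> c m = 0) &
  (forall a, h a = \sum_m c m * \prod_j w a j ^+ m j).
have spn0 k : spn k (fun=> 0).
  by exists (fun=> 0) => // a; rewrite big1// => m _; rewrite mul0r.
have spnD k h1 h2 : spn k h1 -> spn k h2 -> spn k (fun a => h1 a + h2 a).
  move=> [c1 c1k h1E] [c2 c2k h2E]; exists (fun m => c1 m + c2 m).
    by move=> m km; rewrite c1k// c2k// addr0.
  by move=> a; rewrite h1E h2E -big_split; apply: eq_bigr => m _; rewrite mulrDl.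
have spn_mono k c (m : {ffun T -> 'I_E}) : (\sum_j m j <= k)%N ->
    spn k (fun a => c * \prod_j w a j ^+ m j).
  move=> mk; exists (fun m' => if m' == m then c else 0).
    by move=> m'; case: eqP => // ->; rewrite ltnNge mk.
  move=> a; rewrite (bigD1 m)//= eqxx [X in _ + X]big1 ?addr0// => m' /negPf ->.
  by rewrite mul0r.
have spn_leq k k' h : (k <= k')%N -> spn k h -> spn k' h.
  move=> kk' [c ck hE]; exists c => // m k'm; apply: ck.
  exact: leq_ltn_trans k'm.
have spn_sum k (I : finType) (h : I -> A -> R) :
    (forall i, spn k (h i)) -> spn k (fun a => \sum_i h i a).
  move=> spnh; elim: (index_enum I) => [|i s IHs].
    by under eq_fun do rewrite big_nil.
  by under eq_fun do rewrite big_cons; exact: spnD.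
have spn_cst k c : spn k (fun=> c).
  have := @spn_mono k c [ffun=> Ordinal E_gt0].
  rewrite big1; last by move=> j _; rewrite ffunE.
  have -> : (fun a => c * \prod_j w a j ^+ ([ffun=> Ordinal E_gt0] j : 'I_E)) =
            fun=> c.
    apply: funext => a; rewrite big1 ?mulr1// => j _.
    by rewrite ffunE expr0.
  exact.
suff main : forall k, ((E <= k)%N -> forall j, exists2 g, polyfun E.-1 g &
     forall a, w a j ^+ E = g (w a)) ->
    forall h, polyfun k h -> spn k (h \o w).
  by move=> hw /(main _ hw)[c _ cE]; exists c.
elim=> [|k IHk] hw h.
  move e : 0%N => k ph; elim: ph e => {k h}.
  - by move=> *; exact: spn_cst.
  - by move=> D' h1 h2 _ IH1 _ IH2 e; apply: spnD; [exact: IH1|exact: IH2].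
  - by [].
have {}IHk h' : polyfun k h' -> spn k (h' \o w).
  by apply: IHk => Ek; apply: hw; exact: leqW.
move e : k.+1 => k' ph; elim: ph e => {k' h}.
- by move=> *; exact: spn_cst.
- by move=> D' h1 h2 _ IH1 _ IH2 e; apply: spnD; [exact: IH1|exact: IH2].
move=> D' j h ph _ [e]; subst D'.
have [c ck hE] := IHk _ ph.
have -> : (fun x : T -> R => x j * h x) \o w =
   fun a => \sum_m c m * (w a j * \prod_j w a j ^+ m j).
  apply: funext => a /=; rewrite -[h _]/((h \o w) a) hE big_distrr/=.
  by apply: eq_bigr => m _; rewrite mulrCA.
apply: spn_sum => m.
have [->|cm0] := eqVneq (c m) 0; first by under eq_fun do rewrite mul0r.
have mk : (\sum_j m j <= k)%N.
  by rewrite leqNgt; apply: contraNN cm0 => /ck ->.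
pose upd e : {ffun T -> 'I_E} := [ffun i => if i == j then e else m i].
have updE e a : \prod_j w a j ^+ upd e j =
    w a j ^+ e * \prod_(i | i != j) w a i ^+ m i.
  rewrite (bigD1 j)//= ffunE eqxx; congr (_ * _).
  by apply: eq_bigr => i /negPf ij; rewrite ffunE ij.
have updS e : (\sum_j upd e j = e + \sum_(i | i != j) m i)%N.
  rewrite (bigD1 j)//= ffunE eqxx; congr (_ + _)%N.
  by apply: eq_bigr => i /negPf ij; rewrite ffunE ij.
have mS : (\sum_j m j = m j + \sum_(i | i != j) m i)%N by rewrite (bigD1 j).
have mP a : \prod_j w a j ^+ m j = w a j ^+ m j * \prod_(i | i != j) w a i ^+ m i.
  by rewrite (bigD1 j).
have [mj|mj] := ltnP (m j).+1 E.
  have -> : (fun a => c m * (w a j * \prod_j w a j ^+ m j)) =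
    (fun a => c m * \prod_j w a j ^+ upd (Ordinal mj) j).
    by apply: funext => a; rewrite updE mP /= exprS -mulrA.
  by apply: spn_mono; rewrite updS /= addSn ltnS -mS.
have mjE : E = (m j).+1 by apply/eqP; rewrite eqn_leq mj ltn_ord.
have mjE1 : E.-1 = m j by move/(congr1 predn): mjE.
have wE a : w a j ^+ E = w a j * w a j ^+ m j.
  by rewrite -exprS; congr (_ ^+ _).
have Ek : (E <= k.+1)%N.
  by rewrite -(prednK E_gt0) ltnS mjE1 (leq_trans _ mk)// mS leq_addr.
(* The exponent of [j] reaches [E]; replacing the power by [g] lowers the total degree to at most
   [k]. *)
have [g pg gE] := hw Ek j.
have -> : (fun a => c m * (w a j * \prod_j w a j ^+ m j)) =
    (fun x => c m * (g x * \prod_j x j ^+ upd (Ordinal E_gt0) j)) \o w.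
  apply: funext => a /=; rewrite updE expr0 mul1r -gE mP wE.
  by rewrite !mulrA.
apply: (@spn_leq k) => //; apply/IHk/polyfunZ.
apply: (polyfun_leq _ (polyfunM pg
  (polyfun_monomial _ (fun i => upd (Ordinal E_gt0) i)))).
by rewrite updS add0n mjE1 -mS.
Qed.

(** Lagrange interpolation makes the indicator of each point a polynomial, which the relations
    reduce to monomials with exponents below [E]. So the identity matrix of size [s] factors through
    dimension E^#|T|. *)
Lemma card_points_leq (F : fieldType) (T : finType) (E s : nat)
    (w : 'I_s -> T -> F) :
  (0 < E)%N -> injective w ->
  (forall j, exists2 g, polyfun E.-1 g & forall a, w a j ^+ E = g (w a)) ->
  (s <= E ^ #|T|)%N.
Proof.
move=> E_gt0 w_inj hw.
have sep a b : a != b -> exists j, w a j != w b j.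
  move=> ab; apply: contrapT => /forallNP H; move/eqP: ab; apply.
  by apply/w_inj/funext => j; apply/eqP/negPn/negP/H.
(* Each factor uses a coordinate that separates [w a] from [w b]. The default 0 is never reached,
   since [w] is injective. *)
pose ind a x := \prod_(b | b != a)
  (if pselect (exists j, w a j != w b j) is left ex
   then let j := projT1 (cid ex) in (x j - w b j) / (w a j - w b j) else 0).
have indE a b : ind a (w b) = (a == b)%:R.
  rewrite /ind; have [<-|ab] := eqVneq a b.
    rewrite big1// => c ca; case: pselect => [ex|].
      by rewrite /=; case: cid => /= j jne; rewrite divff// subr_eq0.
    by case; apply: sep; rewrite eq_sym.
  rewrite (bigD1 b) 1?eq_sym//=; case: pselect => [ex|].
    by rewrite /= subrr !mul0r.
  by rewrite mul0r.
have ind_poly a : exists D, polyfun D (ind a).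
  exists (\sum_(b | b != a) 1)%N; apply: polyfun_prod => b _.
  case: pselect => [ex|_]; last exact: polyfun_cst.
  rewrite /=; case: cid => /= j _.
  under eq_fun do rewrite mulrC.
  by apply/polyfunZ/polyfunD; [exact: polyfunX|exact: polyfun_cst].
have [c cE] : exists c : 'I_s -> {ffun T -> 'I_E} -> F,
    forall a b, (a == b)%:R = \sum_m c a m * \prod_j w b j ^+ m j.
  have H a : exists c : {ffun T -> 'I_E} -> F,
      forall b, (a == b)%:R = \sum_m c m * \prod_j w b j ^+ m j.
    have [D pD] := ind_poly a.
    have [c cE] := polyfun_reduce E_gt0 (fun _ => hw) pD.
    by exists c => b; rewrite -indE cE.
  exists (fun a => projT1 (cid (H a))) => a; exact: (projT2 (cid (H a))).
pose N := #|{ffun T -> 'I_E}|.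
pose C : 'M[F]_(s, N) := \matrix_(a, k) c a (enum_val k).
pose M : 'M[F]_(N, s) := \matrix_(k, b)
  \prod_j w b j ^+ (enum_val k : {ffun T -> 'I_E}) j.
have CM : C *m M = 1%:M.
  apply/matrixP => a b; rewrite !mxE cE [RHS](reindex (@enum_val _ predT))/=.
    by apply: eq_bigr => k _; rewrite !mxE.
  by apply: onW_bij; exact: enum_val_bij.
have -> : (E ^ #|T|)%N = N by rewrite /N card_ffun card_ord.
rewrite -(mxrank1 F s) -CM (leq_trans (mulmx_max_rank _ _))//.
Qed.

(** * Generic shifts *)

(** Dimension count: with n = #|T|, the B^(n+1) products of powers of the [p i] outnumber the
    monomials that span them. [B] is chosen before [p], so that one base serves all the subfamilies
    in [generic_shift]. *)
Lemma polyfun_algebraic_dependence (F : fieldType) (T : finType) (D : nat) :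
  exists2 B, (0 < B)%N & forall p : 'I_#|T|.+1 -> (T -> F) -> F,
    (forall i, polyfun D (p i)) ->
    exists2 c : {ffun 'I_#|T|.+1 -> 'I_B} -> F, (exists m, c m != 0) &
      forall x, \sum_m c m * \prod_i p i x ^+ m i = 0.
Proof.
(* With L = (n+1)bD, this choice gives (L+1)^n <= (b+1)^n b < (b+1)^(n+1). *)
set n := #|T|; pose b := ((n.+1 * D).+1 ^ n)%N.
exists b.+1 => // p pp.
pose L := (n.+1 * (b * D))%N.
have red (m : {ffun 'I_n.+1 -> 'I_b.+1}) :
    exists c : {ffun T -> 'I_L.+1} -> F,
      forall x, \prod_i p i x ^+ m i = \sum_a c a * \prod_j x j ^+ a j.
  have pm : polyfun L (fun x => \prod_i p i x ^+ m i).
    apply: (@polyfun_leq _ _ (\sum_i (m i * D))%N).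
      rewrite -[L]/(n.+1 * (b * D))%N -[n.+1 in leqRHS]card_ord -sum_nat_const.
      by apply: leq_sum => i _; rewrite leq_mul2r -ltnS ltn_ord orbT.
    by apply: polyfun_prod => i _; exact: polyfunXn.
  have [//|c cE] := @polyfun_reduce _ _ _ (@id (T -> F)) L.+1 L _ isT _ pm.
    by rewrite ltnn.
  by exists c.
pose a m := projT1 (cid (red m)).
have aE (m : {ffun 'I_n.+1 -> 'I_b.+1}) x :
    \prod_i p i x ^+ m i = \sum_k a m k * \prod_j x j ^+ k j.
  exact: (projT2 (cid (red m))).
pose M := {ffun 'I_n.+1 -> 'I_b.+1}; pose K := {ffun T -> 'I_L.+1}.
pose A : 'M[F]_(#|M|, #|K|) := \matrix_(i, k) a (enum_val i) (enum_val k).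
have cardKM : (#|K| < #|M|)%N.
  rewrite !card_ffun !card_ord -/n expnS mulSn.
  apply: (@leq_trans (b.+1 ^ n * (n.+1 * D).+1 ^ n).+1).
    have leL : (L.+1 <= b.+1 * (n.+1 * D).+1)%N by rewrite /L; nia.
    have leq_expl x y k : (x <= y -> x ^ k <= y ^ k)%N.
      by case: k => // k; rewrite leq_exp2r.
    by rewrite ltnS -expnMn leq_expl.
  by rewrite -/b mulnC -add1n leq_add2r expn_gt0.
have : kermx A != 0.
  rewrite -mxrank_eq0 mxrank_ker subn_eq0 -ltnNge.
  exact: leq_ltn_trans (rank_leq_col _) cardKM.
case/rowV0Pn => v /sub_kermxP vA v0.
exists (fun m => v 0 (enum_rank m)).
  have /rV0Pn[i vi] := v0; exists (enum_val i); by rewrite enum_valK.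
move=> x; under eq_bigr do rewrite aE big_distrr/=.
rewrite exchange_big/= big1// => k _.
under eq_bigr do rewrite mulrA.
rewrite -big_distrl/= (reindex (@enum_val _ predT))/=; last first.
  by apply: onW_bij; exact: enum_val_bij.
have /matrixP/(_ 0 (enum_rank k)) := vA; rewrite !mxE => vAk.
apply/eqP; rewrite mulf_eq0; apply/orP; left; apply/eqP; rewrite -[RHS]vAk.
by apply: eq_bigr => i _; rewrite mxE enum_rankK enum_valK.
Qed.

Lemma digits_inj (B n : nat) (f g : nat -> nat) :
  (forall i, f i < B)%N -> (forall i, g i < B)%N ->
  (\sum_(i < n) f i * B ^ i)%N = (\sum_(i < n) g i * B ^ i)%N ->
  forall i, (i < n)%N -> f i = g i.
Proof.
elim: n f g => [//|n IHn] f g fB gB.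
have split_digit (h : nat -> nat) : (\sum_(i < n.+1) h i * B ^ i =
    (\sum_(i < n) h i.+1 * B ^ i) * B + h 0)%N.
  rewrite big_ord_recl expn0 muln1 addnC big_distrl/=; congr (_ + _)%N.
  by apply: eq_bigr => i _; rewrite /bump /= add1n expnSr mulnA.
rewrite !split_digit => e.
have B0 : (0 < B)%N by exact: leq_ltn_trans (fB 0%N).
have e0 : f 0%N = g 0%N.
  by move/(congr1 (modn^~ B)): e; rewrite !modnMDl !modn_small.
have eS : (\sum_(i < n) f i.+1 * B ^ i = \sum_(i < n) g i.+1 * B ^ i)%N.
  by apply/eqP; rewrite -(eqn_pmul2r B0) -(eqn_add2r (f 0%N)) e e0.
case=> [//|i]; rewrite ltnS.
by apply: (IHn (f \o S) (g \o S)) eS i => j /=; [exact: fB|exact: gB].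
Qed.

Lemma sum_digits_inj (B n : nat) (J : finType) (h : J -> 'I_n)
    (m1 m2 : {ffun J -> 'I_B}) :
  injective h ->
  (\sum_k m1 k * B ^ h k)%N = (\sum_k m2 k * B ^ h k)%N -> m1 = m2.
Proof.
move=> h_inj e; apply/ffunP => k0; apply: val_inj.
have B0 : (0 < B)%N by exact: leq_ltn_trans (ltn_ord (m1 k0)).
pose dig (m : {ffun J -> 'I_B}) (i : nat) := (\sum_(k | h k == i :> nat) m k)%N.
have digE m k : dig m (h k) = m k.
  rewrite /dig (bigD1 k)//= big1 ?addn0// => k' /andP[/eqP hk /eqP].
  by move/val_inj/h_inj : hk.
have dig_lt m i : (dig m i < B)%N.
  have [[k <-]|nh] := pselect (exists k, h k = i :> nat).
    by rewrite digE ltn_ord.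
  rewrite /dig big1// => k /eqP hk; case: nh; by exists k.
have sumE (m : {ffun J -> 'I_B}) :
    (\sum_k m k * B ^ h k = \sum_(i < n) dig m i * B ^ i)%N.
  rewrite (partition_big h predT)//=; apply: eq_bigr => i _.
  rewrite /dig big_distrl/=; by apply: eq_big => // k /eqP ->.
rewrite !sumE in e.
by have := digits_inj (dig_lt m1) (dig_lt m2) e (ltn_ord (h k0)); rewrite !digE.
Qed.

Lemma finite_pos_lb (R : realFieldType) (I : finType) (f : I -> R) :
  (forall i, 0 < f i) -> exists2 e, 0 < e & forall i, e <= f i.
Proof.
move=> f0; exists (\big[Num.min/1]_i f i); last by move=> i; exact: bigmin_le.
by elim/big_ind: _ => // x y x0 y0; rewrite lt_min x0.
Qed.

(** The points e / (i+2) with i < size Q are too many to be all roots. *)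
Lemma poly_nonroot (R : realFieldType) (Q : {poly R}) (e : R) :
  Q != 0 -> 0 < e -> exists2 s, 0 < s < e & Q.[s] != 0.
Proof.
move=> Q0 e0; apply: contrapT => H.
pose rs := [seq e / (i.+2)%:R | i <- iota 0 (size Q)].
have rs_root : all (root Q) rs.
  apply/allP => _ /mapP[i _ ->]; apply/negPn/negP => nr; apply: H.
  exists (e / i.+2%:R) => //.
  by rewrite divr_gt0//= ltr_pdivrMr// ltr_pMr// ltr1n.
have rs_uniq : uniq rs.
  rewrite map_inj_uniq ?iota_uniq// => i j /(mulfI (lt0r_neq0 e0))/invr_inj/eqP.
  by rewrite eqr_nat => /eqP[].
by have := max_poly_roots Q0 rs_root rs_uniq; rewrite size_map size_iota ltnn.
Qed.

Lemma polyfun_continuous (R : realType) (T : finType) D (f : (T -> R) -> R) :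
  polyfun D f ->
  continuous (fun v : 'rV[R]_#|T| => f (fun t => v 0 (enum_rank t))).
Proof.
elim=> {D f}.
- by move=> D c; exact: cst_continuous.
- by move=> D f g _ IHf _ IHg v; exact: (continuousD (IHf v) (IHg v)).
- move=> D j f _ IHf v; apply: (continuousM _ (IHf v)).
  exact: coord_continuous.
Qed.

Lemma polyfun_nonzero_near (R : realType) (T : finType) D (f : (T -> R) -> R)
    (x : T -> R) :
  polyfun D f -> f x != 0 -> exists2 e, 0 < e &
    forall y, (forall t, `|x t - y t| < e) -> f y != 0.
Proof.
move=> pf fx0.
pose row (x : T -> R) : 'rV[R]_#|T| := \row_k x (enum_val k).
have rowE y : (fun t => row y 0 (enum_rank t)) = y.
  by apply: funext => t; rewrite mxE enum_rankK.
have := @polyfun_continuous _ _ _ _ pf (row x) [set r | r != 0].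
rewrite rowE => H.
have /H/nbhs_ballP[e /= e0 He] : nbhs (f x) [set r | r != 0].
  by apply: open_nbhs_nbhs; split => //; exact: open_neq.
exists e => // y xy; rewrite -[y]rowE; apply: (He (row y)).
by split=> // i k; rewrite !mxE; exact: xy.
Qed.

(* With [ev i = s ^ (B ^ i)], distinct monomials in [ev] are distinct powers of
   [s], so that any finite family of nonzero polynomials is nonzero at [ev] for
   all but finitely many [s].  This is applied to the polynomial relations
   satisfied by the subfamilies of [p] with [#|T| + 1] elements. *)
Lemma generic_shift (R : realType) (I T : finType) D
    (p : I -> (T -> R) -> R) (e0 : R) :
  (forall i, polyfun D (p i)) -> 0 < e0 ->
  exists2 ev : I -> R, (forall i, 0 < ev i < e0) & exists2 eta, 0 < eta &
    forall x, (#|[pred i | (`|ev i - p i x| < eta)%R]| <= #|T|)%N.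
Proof.
move=> pp e0_gt0; set n := #|T|.
have [B B_gt0 HB] := polyfun_algebraic_dependence R T D; rewrite -/n in HB.
pose H := {h : {ffun 'I_n.+1 -> I} | injectiveb h}.
have rel (h : H) := HB (fun k => p (val h k)) (fun k => pp _).
pose c h := s2val (cid2 (rel h)).
have cn0 h : exists m, c h m != 0 := s2valP (cid2 (rel h)).
have cE h x : \sum_m c h m * \prod_k p (val h k) x ^+ m k = 0.
  exact: (s2valP' (cid2 (rel h))).
pose ex (h : H) (m : {ffun 'I_n.+1 -> 'I_B}) :=
  (\sum_k m k * B ^ enum_rank (val h k))%N.
have ex_inj h : injective (ex h).
  move=> m1 m2; apply: (@sum_digits_inj _ _ _ (fun k => enum_rank (val h k))).
  by move=> k k' /enum_rank_inj; exact/injectiveP/(valP h).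
pose Q h : {poly R} := \sum_m c h m *: 'X^(ex h m).
have Qn0 h : Q h != 0.
  have [m cm] := cn0 h; apply: contraNneq cm => /(congr1 (coefp (ex h m))).
  rewrite /= coef0 coef_sum (bigD1 m)//= coefZ coefXn eqxx mulr1 big1 ?addr0.
    by move->.
  move=> m' m'm; rewrite coefZ coefXn [_ == _]negbTE ?mulr0//.
  by apply: contraNneq m'm => /ex_inj ->.
have PQ0 : \prod_h Q h != 0 by apply/prodf_neq0 => h _.
(* The bound s < 1 makes every [ev i] at most s, hence less than [e0]. *)
have [] := @poly_nonroot _ _ (Num.min e0 1) PQ0.
  by rewrite lt_min e0_gt0 ltr01.
move=> s /andP[s0]; rewrite lt_min => /andP[se0 s1] Qs.
have {}Qs h : (Q h).[s] != 0.
  by move: Qs; rewrite horner_prod => /prodf_neq0; exact.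
pose ev (i : I) := s ^+ (B ^ enum_rank i).
pose G h (u : 'I_n.+1 -> R) := \sum_m c h m * \prod_k u k ^+ m k.
have Gpoly h : polyfun (n.+1 * B) (G h).
  apply: polyfun_sum => m _; apply: polyfunZ.
  apply: (polyfun_leq _ (polyfun_monomial _ (fun k => m k : nat))).
  rewrite -[n.+1 in leqRHS]card_ord -sum_nat_const.
  by apply: leq_sum => k _; rewrite ltnW.
have Gev h : G h (fun k => ev (val h k)) != 0.
  rewrite (_ : G _ _ = (Q h).[s])// /G /Q horner_sum; apply: eq_bigr => m _.
  rewrite hornerZ hornerXn /ex -prodrXr; congr (_ * _).
  by apply: eq_bigr => k _; rewrite /ev -exprM mulnC.
(* The relation of [h] holds at the values of the [p i] but is nonzero near the [ev i]. Hence at no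
   point are all n+1 values within [eta_ h] of their shifts. *)
pose eta_ h := s2val (cid2 (polyfun_nonzero_near (Gpoly h) (Gev h))).
have eta_gt0 h : 0 < eta_ h := s2valP (cid2 (polyfun_nonzero_near (Gpoly h) (Gev h))).
have eta_P (h : H) (y : 'I_n.+1 -> R) :
    (forall k, `|ev (val h k) - y k| < eta_ h) -> G h y != 0.
  exact: (s2valP' (cid2 (polyfun_nonzero_near (Gpoly h) (Gev h)))).
have [eta eta0 etaP] := finite_pos_lb eta_gt0.
exists ev.
  move=> i; rewrite exprn_gt0//=; apply: le_lt_trans se0.
  by rewrite /ev ler_iXnr ?(ltW s0) ?(ltW s1)// expn_gt0 B_gt0.
exists eta => // x; rewrite leqNgt; apply/negP => nS.
set S := [pred i | _] in nS.
have [h hS] : exists h : H, forall k, val h k \in S.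
  have hi : injectiveb [ffun k : 'I_n.+1 => enum_val (widen_ord nS k)].
    apply/injectiveP => k k'; rewrite !ffunE => /enum_val_inj/(congr1 val)/=.
    exact: val_inj.
  exists (exist (fun h : {ffun 'I_n.+1 -> I} => injectiveb h) _ hi) => k /=.
  by rewrite ffunE enum_valP.
suff : G h (fun k => p (val h k) x) != 0 by rewrite /G cE eqxx.
apply: eta_P => k; apply: lt_le_trans (etaP h).
by have := hS k; rewrite inE.
Qed.

(** * Minimisers of penalised polynomials *)

Definition shift_coord (R : realType) (T : finType) (x : T -> R) (j : T)
    (s : R) : T -> R :=
  fun i => x i + s * (i == j)%:R.

Lemma is_derive_addf (R : realType) (f g : R -> R) (s df dg : R) :
  is_derive s (1 : R) f df -> is_derive s (1 : R) g dg ->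
  is_derive s (1 : R) (fun t => f t + g t) (df + dg).
Proof. exact: is_deriveD. Qed.

Lemma is_derive_mulf (R : realType) (f g : R -> R) (s df dg : R) :
  is_derive s (1 : R) f df -> is_derive s (1 : R) g dg ->
  is_derive s (1 : R) (fun t => f t * g t) (f s * dg + g s * df).
Proof. exact: is_deriveM. Qed.

Lemma is_derive_expf (R : realType) (f : R -> R) n (s df : R) :
  is_derive s (1 : R) f df ->
  is_derive s (1 : R) (fun t => f t ^+ n.+1) (n.+1%:R * f s ^+ n * df).
Proof.
move=> fdf; have := is_deriveX n.+1 fdf.
by rewrite (_ : f ^+ n.+1 = fun t => f t ^+ n.+1)// exprfctE.
Qed.

Lemma is_derive_bigsum (R : realType) (I : Type) (r : seq I) (P : pred I)
    (f : I -> R -> R) (df : I -> R) (s : R) :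
  (forall i, P i -> is_derive s (1 : R) (f i) (df i)) ->
  is_derive s (1 : R) (fun t => \sum_(i <- r | P i) f i t)
    (\sum_(i <- r | P i) df i).
Proof.
move=> fdf; elim: r => [|i r IHr].
  rewrite big_nil; under eq_fun do rewrite big_nil.
  exact: is_derive_cst.
rewrite big_cons; case Pi : (P i).
  have -> : (fun t => \sum_(j <- i :: r | P j) f j t) =
            fun t => f i t + \sum_(j <- r | P j) f j t.
    by apply: funext => t; rewrite big_cons Pi.
  by apply: is_derive_addf => //; exact: fdf.
rewrite (_ : (fun t => _) = fun t => \sum_(j <- r | P j) f j t)//.
by apply: funext => t; rewrite big_cons Pi.
Qed.

Lemma is_derive_shift_coord (R : realType) (T : finType) (x : T -> R) j i s :
  is_derive s (1 : R) (fun s => shift_coord x j s i) (i == j)%:R.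
Proof.
rewrite /shift_coord.
apply: (@is_derive_eq _ _ _ _ _ _ _ (0 + (s * 0 + (i == j)%:R * 1))).
  apply: (@is_derive_addf _ (fun=> x i) (fun s => s * (i == j)%:R)).
  exact: (@is_derive_mulf _ id (fun=> (i == j)%:R)).
by rewrite mulr0 !add0r mulr1.
Qed.

Lemma polyfun_derive (R : realType) (T : finType) D (f : (T -> R) -> R) (j : T) :
  polyfun D f -> exists2 g, polyfun D.-1 g &
    forall x s, is_derive s (1 : R) (fun s => f (shift_coord x j s))
                  (g (shift_coord x j s)).
Proof.
move=> pf.
(* The extra clause serves [D = 0], where [D.-1] is 0 again: in the product rule, a variable times
   the derivative then has degree 0 only because the derivative vanishes. *)
suff [g [_ pg gE]] : exists g, [/\ D = 0%N -> g = fun=> 0, polyfun D.-1 g &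
    forall x s, is_derive s (1 : R) (fun s => f (shift_coord x j s))
                  (g (shift_coord x j s))] by exists g.
elim: pf => {D f}.
- move=> D c; exists (fun=> 0); split=> //; first exact: polyfun_cst.
  by move=> x s /=; exact: is_derive_cst.
- move=> D f1 f2 _ [g1 [g10 pg1 g1E]] _ [g2 [g20 pg2 g2E]].
  exists (fun x => g1 x + g2 x); split; first 2 last.
  + by move=> x s; exact: is_derive_addf.
  + by move=> D0; rewrite g10// g20//; apply: funext => x; rewrite addr0.
  + exact: polyfunD.
- move=> D i f pf [g [g0 pg gE]].
  exists (fun x => x i * g x + f x * (i == j)%:R); split=> //.
  + apply: polyfunD; last first.
      by under eq_fun do rewrite mulrC; exact: polyfunZ.
    case: D g0 pf pg => [|D] g0 pf pg; last exact: polyfunXM.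
    rewrite g0//; under eq_fun do rewrite mulr0; exact: polyfun_cst.
  + move=> x s; apply: is_derive_mulf => //.
    exact: is_derive_shift_coord.
Qed.

(** Squared violation of a sign condition: [true] asks for u >= 0 and [false] for u <= 0. *)
Definition penalty (R : realType) (b : bool) (u : R) : R :=
  Num.max 0 (if b then - u else u) ^+ 2.

Lemma penalty_ge0 (R : realType) b (u : R) : 0 <= penalty b u.
Proof. exact: sqr_ge0. Qed.

Lemma penalty_eq0 (R : realType) b (u : R) :
  (if b then - u else u) <= 0 -> penalty b u = 0.
Proof. by move=> u0; rewrite /penalty max_l// expr0n. Qed.

Lemma penalty_sqr (R : realType) b (u : R) :
  0 <= (if b then - u else u) -> penalty b u = u ^+ 2.
Proof. by move=> u0; rewrite /penalty max_r//; case: b u0; rewrite ?sqrrN. Qed.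

Lemma penalty_le (R : realType) b (u : R) : penalty b u <= u ^+ 2.
Proof.
have [u0|/ltW u0] := lerP (if b then - u else u) 0.
  by rewrite penalty_eq0// sqr_ge0.
by rewrite penalty_sqr.
Qed.

Lemma penalty_continuous (R : realType) b : continuous (@penalty R b).
Proof.
have cb : continuous (fun u : R => if b then - u else u).
  by case: b; [exact: opp_continuous|move=> u; exact: cvg_id].
have cm : continuous (fun u : R => Num.max 0 (if b then - u else u)).
  by move=> u; apply: continuous_max; [exact: cst_continuous|exact: cb].
move=> u; exact: (continuousM (cm u) (cm u)).
Qed.

Lemma continuous_bigsum (R : realType) (X : topologicalType) (I : Type)
    (r : seq I) (f : I -> X -> R) :
  (forall i, continuous (f i)) -> continuous (fun x => \sum_(i <- r) f i x).
Proof.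
move=> cf; elim: r => [|i r IHr].
  by under eq_fun do rewrite big_nil; exact: cst_continuous.
under eq_fun do rewrite big_cons.
by move=> x; exact: (continuousD (cf i x) (IHr x)).
Qed.

(** The even powers make [F] coercive: the points with F x <= F a lie in a compact box, on which the
    continuous [F] attains its minimum. *)
Lemma penalized_min (R : realType) (T I : finType) D k
    (q : I -> (T -> R) -> R) (sg : I -> bool) (c : R) (a : T -> R) :
  (forall i, polyfun D (q i)) -> 0 <= c ->
  let F x := \sum_t x t ^+ k.+1.*2 + c * \sum_i penalty (sg i) (q i x) in
  exists w, forall x, F w <= F x.
Proof.
move=> pq c0 F.
have F0 x : \sum_t x t ^+ k.+1.*2 <= F x.
  by rewrite lerDl mulr_ge0// sumr_ge0// => i _; exact: penalty_ge0.
have xF x t : x t ^+ k.+1.*2 <= F x.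
  apply: le_trans (F0 x); rewrite (bigD1 t)//= lerDl sumr_ge0// => s _.
  by rewrite exprn_even_ge0// odd_double.
have Fa0 : 0 <= F a.
  apply: le_trans (F0 a); rewrite sumr_ge0// => s _.
  by rewrite exprn_even_ge0// odd_double.
(* As M >= 1, a coordinate with |x_t| > M has x_t^(2k+2) >= |x_t| > F a. *)
pose M := 1 + F a.
pose G (v : 'rV[R]_#|T|) := F (fun t => v 0 (enum_rank t)).
have cG : continuous G.
  have cX : continuous (fun v : 'rV[R]_#|T| =>
      \sum_t v 0 (enum_rank t) ^+ k.+1.*2).
    apply: continuous_bigsum => t.
    exact: (@polyfun_continuous _ _ _ (fun x => x t ^+ k.+1.*2)
      (polyfunXn _ (polyfunX _ t))).
  have cP : continuous (fun v : 'rV[R]_#|T| =>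
      c * \sum_i penalty (sg i) (q i (fun t => v 0 (enum_rank t)))).
    have cS : continuous (fun v : 'rV[R]_#|T| =>
      \sum_i penalty (sg i) (q i (fun t => v 0 (enum_rank t)))).
      apply: continuous_bigsum => i v.
      apply: (@continuous_comp _ _ _ (fun v : 'rV[R]_#|T| => q i _)).
        exact: (polyfun_continuous (pq i)).
      exact: penalty_continuous.
    move=> v; apply: (@continuousM _ _ (fun=> c)) (cS v).
    exact: cst_continuous.
  by move=> v; exact: (continuousD (cX v) (cP v)).
pose A : set 'rV[R]_#|T| := [set v | forall i, `[-M, M]%classic (v ord0 i)].
have cA : compact A.
  apply: (@rV_compact _ _ (fun=> `[-M, M]%classic)).
  by move=> _; exact: segment_compact.
have inA x : F x <= F a -> A (\row_i x (enum_val i)).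
  move=> xa i /=; rewrite mxE in_itv/= -ler_norml leNgt; apply/negP => Mx.
  have M1 : 1 <= M by rewrite lerDl.
  have : x (enum_val i) ^+ k.+1.*2 <= F a by exact: le_trans (xF _ _) xa.
  rewrite leNgt => /negP; apply.
  rewrite -[x _ ^+ _]ger0_norm ?exprn_even_ge0 ?odd_double// normrX.
  apply: (@lt_le_trans _ _ M); first by rewrite ltrDr.
  apply: le_trans (ltW Mx) _.
  by rewrite doubleS ler_eXnr// (le_trans M1)// ltW.
have rowE x : (fun t => (\row_i x (enum_val i) : 'rV[R]_#|T|) 0 (enum_rank t)) = x.
  by apply: funext => t; rewrite mxE enum_rankK.
have [|w _ wmin] := EVT_min_rV _ cA (continuous_subspaceT cG).
  by exists (\row_i a (enum_val i)); exact: inA.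
exists (fun t => w 0 (enum_rank t)) => x.
have wm y : F y <= F a -> F (fun t => w 0 (enum_rank t)) <= F y.
  by move=> ya; have := wmin _ (mem_set (inA _ ya)); rewrite /G rowE.
have [xa|/ltW ax] := leP (F x) (F a); first exact: wm.
by apply: le_trans ax; exact: wm.
Qed.

(* The sum keeps the violated constraints and, among those with [q i w = 0], the
   ones with [sg i = false]: the latter contribute nothing, but with them the
   set of indices and [w] determine [sg]. *)
Lemma penalized_min_stationary (R : realType) (T I : finType) D k
    (q : I -> (T -> R) -> R) (dq : I -> T -> (T -> R) -> R)
    (sg : I -> bool) (c : R) (w : T -> R) :
  (forall i, polyfun D (q i)) ->
  (forall i j x s, is_derive s (1 : R) (fun s => q i (shift_coord x j s))
                     (dq i j (shift_coord x j s))) ->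
  0 <= c ->
  let F x := \sum_t x t ^+ k.+1.*2 + c * \sum_i penalty (sg i) (q i x) in
  (forall x, F w <= F x) ->
  forall j, k.+1%:R * w j ^+ k.*2.+1 +
    c * \sum_(i | sg i != (0 <= q i w)) q i w * dq i j w = 0.
Proof.
move=> pq hdq c0 F wmin j.
pose v b (u : R) := if b then - u else u.
pose J := [pred i | 0 <= v (sg i) (q i w)].
(* Near [w] along a coordinate line, F <= FJ: outside [J] the penalties stay 0, and in [J] each is
   at most the square. Equality holds at [w], which is thus a local minimum of the differentiable
   [FJ]. *)
pose FJ x := \sum_t x t ^+ k.+1.*2 + c * \sum_(i | J i) q i x ^+ 2.
pose dFJ x := \sum_t (k.+1.*2%:R * x t ^+ k.*2.+1 * (t == j)%:R) +
   (c * (\sum_(i | J i) 2%:R * q i x ^+ 1 * dq i j x) +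
    (\sum_(i | J i) q i x ^+ 2) * 0).
have dFJP x s : is_derive s (1 : R) (fun s => FJ (shift_coord x j s))
    (dFJ (shift_coord x j s)).
  apply: (@is_derive_addf _ (fun s => \sum_t shift_coord x j s t ^+ k.+1.*2)
    (fun s => c * \sum_(i | J i) q i (shift_coord x j s) ^+ 2)).
    apply: (@is_derive_bigsum _ _ _ _ (fun t s => shift_coord x j s t ^+ k.+1.*2)).
    move=> t _; apply: (@is_derive_expf _ (fun s => shift_coord x j s t)).
    exact: is_derive_shift_coord.
  apply: (@is_derive_mulf _ (fun=> c)
    (fun s => \sum_(i | J i) q i (shift_coord x j s) ^+ 2)).
  apply: (@is_derive_bigsum _ _ _ _ (fun i s => q i (shift_coord x j s) ^+ 2)).
  move=> i _; exact: (@is_derive_expf _ (fun s => q i (shift_coord x j s))).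
have shift0 (x : T -> R) : shift_coord x j 0 = x.
  by apply: funext => t; rewrite /shift_coord mul0r addr0.
have nearJ : \forall s \near (0 : R), forall i, ~~ J i ->
    v (sg i) (q i (shift_coord w j s)) < 0.
  suff nearJi i : \forall s \near (0 : R), ~~ J i ->
      v (sg i) (q i (shift_coord w j s)) < 0 by exact: filter_forall nearJi.
  have [Ji|nJi] := boolP (J i); first by apply: filterS filterT => s _.
  have ci : {for 0, continuous (fun s => q i (shift_coord w j s))}.
    apply: differentiable_continuous; apply/derivable1_diffP.
    by have [] := hdq i j w 0.
  have cv : {for 0, continuous (fun s => v (sg i) (q i (shift_coord w j s)))}.
    rewrite /v; case: (sg i); last exact: ci.
    by move=> ? ?; exact: (continuousN ci).
  have : v (sg i) (q i w) < 0 by rewrite ltNge.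
  rewrite -{1}(shift0 w) => vlt.
  have : \forall s \near (0 : R), v (sg i) (q i (shift_coord w j s)) < 0.
    exact: (cvgr_lt _ cv _ vlt).
  by apply: filterS => s vs _.
have [e /= e0 He] : nbhs_ball (0 : R) (fun s => forall i, ~~ J i ->
    v (sg i) (q i (shift_coord w j s)) < 0) by exact/nbhs_ballP.
have FJw : FJ w = F w.
  rewrite /FJ /F; congr (_ + _ * _); rewrite [RHS](bigID J)/=.
  rewrite [X in _ + X]big1 ?addr0.
    by apply: eq_bigr => i Ji; rewrite penalty_sqr.
  by move=> i /= nJi; rewrite penalty_eq0// ltW// ltNge.
have FJmin s : s \in `](- e), e[ -> FJ (shift_coord w j 0) <= FJ (shift_coord w j s).
  rewrite in_itv/= -ltr_norml => se.
  rewrite shift0 FJw; apply: le_trans (wmin (shift_coord w j s)) _.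
  rewrite lerD2l ler_wpM2l// (bigID J)/= [X in _ + X]big1 ?addr0.
    by apply: ler_sum => i _; exact: penalty_le.
  move=> i nJi; rewrite penalty_eq0//; apply/ltW/He => //.
  by rewrite /ball/= sub0r normrN.
have D0 : is_derive (0 : R) (1 : R) (fun s => FJ (shift_coord w j s)) 0.
  apply: (@derive1_at_min _ _ (- e) e) => //.
  - by apply: le_trans (ltW e0); rewrite oppr_le0 ltW.
  - by rewrite in_itv/= oppr_lt0 e0.
have : dFJ w = 0.
  have := @derive_val _ _ _ _ _ _ _ (dFJP w 0).
  by rewrite (@derive_val _ _ _ _ _ _ _ D0) shift0.
rewrite /dFJ mulr0 addr0 (bigD1 j)//= eqxx mulr1 big1 ?addr0; last first.
  by move=> t /negPf ->; rewrite mulr0.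
(* The indices of [J] outside the smaller sum satisfy q i w = 0. *)
have -> : \sum_(i | J i) 2%:R * q i w ^+ 1 * dq i j w =
    2%:R * \sum_(i | sg i != (0 <= q i w)) q i w * dq i j w.
  rewrite big_distrr/= (bigID (fun i => sg i != (0 <= q i w)))/=.
  rewrite [X in _ + X]big1 ?addr0.
    apply: eq_big => [i|i _]; last by rewrite expr1 mulrA.
    rewrite /v; case: (sg i); case: (leP 0 (q i w)) => //= qw; rewrite ?andbF//.
    by rewrite oppr_ge0 ltW.
  move=> i /andP[]; rewrite negbK /J /= /v => + /eqP sgi.
  rewrite sgi; case: ifP => [q0|/negbT].
    rewrite oppr_ge0 => q0'; rewrite (_ : q i w = 0) ?expr1 ?mulr0 ?mul0r//.
    by apply/eqP; rewrite eq_le q0 q0'.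
  by move=> /negPf ->.
rewrite -muln2 natrM => e2.
apply: (@mulfI _ (2%:R : R)); first by rewrite pnatr_eq0.
by rewrite mulr0 -[RHS]e2; ring.
Qed.

(** * Sign patterns *)

Lemma card_le_preimages (Q P : finType) (f : Q -> P) (D : {pred P}) (B : nat) :
  (forall a, f a \in D) -> (forall y, #|[pred a | f a == y]| <= B)%N ->
  (#|Q| <= #|D| * B)%N.
Proof.
move=> fD fib; rewrite -[leqLHS]sum1_card (partition_big f (mem D))//=.
rewrite -sum_nat_const; apply: leq_sum => y _.
by rewrite (leq_trans _ (fib y))// sum1_card.
Qed.

Lemma card_subsets_leq (I : finType) (n : nat) :
  #|[pred S : {set I} | #|S| <= n]%N| = (\sum_(j < n.+1) 'C(#|I|, j))%N.
Proof.
rewrite -[LHS]sum1_card.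
rewrite [LHS](partition_big (fun S : {set I} => inord #|S| : 'I_n.+1) predT)//=.
apply: eq_bigr => j _; rewrite -card_draws -sum1_card.
apply: eq_bigl => S; rewrite !inE; apply/andP/eqP => [[Sn /eqP <-]|Sj].
  by rewrite inordK.
by rewrite Sj -ltnS ltn_ord; split=> //; apply/eqP/val_inj; rewrite /= inordK.
Qed.

(* A sign pattern [sg] realised at [x a] is sent to a minimiser [w] of
   [sum_t x_t^(2k+2) + c sum_i penalty (sg i) (q i x)], where the [q i] are the
   [p i] slightly lowered, and to the set [A] of the [i] such that [q i w] has
   the wrong sign. The pair [(w, A)] determines [sg]; [w] solves a polynomial
   system that depends on [A] only; and [A] has at most [#|T|] elements, since
   for large [c] all the [q i w] with [i] in [A] are close to zero. *)
Lemma card_sign_patterns (R : realType) (T I Q : finType) (D k B : nat)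
    (p : I -> (T -> R) -> R) (dp : I -> T -> (T -> R) -> R)
    (x : Q -> T -> R) :
  (forall i, polyfun D (p i)) ->
  (forall i j x s, is_derive s (1 : R) (fun s => p i (shift_coord x j s))
                     (dp i j (shift_coord x j s))) ->
  (forall (ev : I -> R) (c : R) (A : {set I}) s (w : 'I_s -> T -> R),
     0 <= c -> injective w ->
     (forall a j, k.+1%:R * w a j ^+ k.*2.+1 +
       c * \sum_(i in A) (p i (w a) - ev i) * dp i j (w a) = 0) ->
     (s <= B)%N) ->
  (forall a b, (forall i, (0 < p i (x a)) = (0 < p i (x b))) -> a = b) ->
  (#|Q| <= B * \sum_(j < #|T|.+1) 'C(#|I|, j))%N.
Proof.
move=> pp hdp hB x_inj.
(* Lowering the [p i] by positive amounts less than [e0] keeps the pattern at each [x a] and leaves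
   no zero value there. *)
have [e0 e0_gt0 e0P] : exists2 e0 : R, 0 < e0 &
    forall a i, 0 < p i (x a) -> e0 <= p i (x a).
  have [|e0 e0_gt0 e0P] := @finite_pos_lb R (Q * I)%type
      (fun z => if 0 < p z.2 (x z.1) then p z.2 (x z.1) else 1).
    by move=> z; case: ifP => // _; exact: ltr01.
  by exists e0 => // a i pai; have := e0P (a, i); rewrite /= pai.
have [ev ev_bnd [eta eta0 etaP]] := generic_shift pp e0_gt0.
pose q i x := p i x - ev i.
have pq i : polyfun D (q i) by apply: polyfunD => //; exact: polyfun_cst.
have hdq i j y s : is_derive s (1 : R) (fun s => q i (shift_coord y j s))
                     (dp i j (shift_coord y j s)).
  rewrite -[X in is_derive _ _ _ X]addr0.
  apply: (@is_derive_addf _ (fun s => p i (shift_coord y j s))) => //.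
pose sg a i := 0 < p i (x a).
have sgP a i : if sg a i then 0 < q i (x a) else q i (x a) < 0.
  have /andP[ev0 eve0] := ev_bnd i; rewrite /sg /q; case: ifPn => [pai|].
    by rewrite subr_gt0; apply: lt_le_trans eve0 _; exact: e0P.
  by rewrite -leNgt subr_lt0 => pai; exact: le_lt_trans ev0.
pose phi (y : T -> R) := \sum_t y t ^+ k.+1.*2.
have phi0 y : 0 <= phi y.
  by rewrite sumr_ge0// => t _; rewrite exprn_even_ge0// odd_double.
pose M := 1 + \sum_a phi (x a).
have phiM a : phi (x a) < M.
  rewrite (@le_lt_trans _ _ (\sum_a phi (x a)))// ?ltrDr//.
  by rewrite (bigD1 a)//= lerDl sumr_ge0.
have M0 : 0 < M by rewrite ltr_pwDl// sumr_ge0.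
(* The minimum is at most phi (x a) < M, so each [i] in [A a] has c q^2 < M, that is |q| < eta;
   [generic_shift] then bounds the size of [A a]. *)
pose c := M / eta ^+ 2.
have c0 : 0 <= c by rewrite divr_ge0 ?ltW// exprn_gt0.
pose w a := projT1 (cid (@penalized_min R T I D k q (sg a) c (x a) pq c0)).
have wmin a y : phi (w a) + c * \sum_i penalty (sg a i) (q i (w a)) <=
    phi y + c * \sum_i penalty (sg a i) (q i y).
  exact: (projT2 (cid (@penalized_min R T I D k q (sg a) c (x a) pq c0)) y).
pose A a := [set i | sg a i != (0 <= q i (w a))]%SET.
have wA a j : k.+1%:R * w a j ^+ k.*2.+1 +
    c * \sum_(i in A a) q i (w a) * dp i j (w a) = 0.
  rewrite -[RHS](penalized_min_stationary pq hdq c0 (wmin a) j).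
  by congr (_ + _ * _); apply: eq_bigl => i; rewrite inE.
have cardA a : (#|A a| <= #|T|)%N.
  apply: leq_trans (etaP (w a)); apply/subset_leq_card/fintype.subsetP => i.
  rewrite !inE => Ai.
  have pen : penalty (sg a i) (q i (w a)) = q i (w a) ^+ 2.
    apply: penalty_sqr; move: Ai; case: (sg a i); case: leP => // qi _.
    by rewrite oppr_ge0 ltW.
  have : c * q i (w a) ^+ 2 < M.
    apply: le_lt_trans (phiM a).
    have pen0 : \sum_i penalty (sg a i) (q i (x a)) = 0.
      apply: big1 => i' _; apply: penalty_eq0; have := sgP a i'.
      by case: (sg a i') => qi; rewrite ?oppr_le0 ltW.
    have := wmin a (x a); rewrite pen0 mulr0 addr0.
    apply: le_trans; rewrite -pen (bigD1 i)//=.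
    rewrite ler_wpDl// mulrDr lerDl mulr_ge0// sumr_ge0// => *.
    exact: penalty_ge0.
  rewrite /c mulrAC ltr_pdivrMr ?exprn_gt0// ltr_pM2l//.
  rewrite distrC -/(q i _) -[q _ _ ^+ 2]real_normK ?num_real//.
  by rewrite ltr_sqr// nnegrE ?normr_ge0// ltW.
rewrite mulnC -card_subsets_leq; apply: (card_le_preimages cardA) => S.
apply: (hB ev c S _ (fun i => w (enum_val i))) => //.
  move=> i j wij; apply: enum_val_inj.
  have /eqP Ai := enum_valP i; have /eqP Aj := enum_valP j.
  apply: x_inj => n; rewrite -/(sg _ n) -/(sg _ n).
  have /setP/(_ n) := etrans Ai (esym Aj); rewrite !inE wij.
  by case: (sg _ n); case: (sg _ n); case: (0 <= _).
move=> i j; have /eqP Ai := enum_valP i.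
by rewrite -[RHS](wA (enum_val i) j) Ai.
Qed.

(** The equations are linear for [k = 0]. Pairing the difference dw of two solutions with the
    difference of their equations gives |dw|^2 + c sum_i <b_i, dw>^2 = 0, so the solution is unique
    and [B] is 1. *)
Lemma card_sign_patterns_affine (R : realType) (T I Q : finType)
    (b : I -> T -> R) (b0 : I -> R) (x : Q -> T -> R) :
  (forall a a', (forall i, (0 < \sum_t b i t * x a t + b0 i) =
                           (0 < \sum_t b i t * x a' t + b0 i)) -> a = a') ->
  (#|Q| <= \sum_(j < #|T|.+1) 'C(#|I|, j))%N.
Proof.
move=> x_inj; rewrite -[leqRHS]mul1n.
pose p i (y : T -> R) := \sum_t b i t * y t + b0 i.
apply: (@card_sign_patterns R T I Q 1 0 1 p (fun i j _ => b i j) x) => //.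
- move=> i; apply: polyfunD; last exact: polyfun_cst.
  by apply: polyfun_sum => t _; apply: polyfunZ; exact: polyfunX.
- move=> i j y s; rewrite -[X in is_derive _ _ _ X]addr0.
  apply: (@is_derive_addf _ (fun s => \sum_t b i t * shift_coord y j s t)) => //.
  have -> : b i j = \sum_t (b i t * (t == j)%:R + shift_coord y j s t * 0).
    rewrite (bigD1 j)//= eqxx mulr1 mulr0 addr0 big1 ?addr0//.
    by move=> t /negPf ->; rewrite !mulr0 addr0.
  apply: (@is_derive_bigsum _ _ _ _ (fun t s => b i t * shift_coord y j s t)).
  move=> t _; apply: (@is_derive_mulf _ (fun=> b i t)).
  exact: is_derive_shift_coord.
move=> ev c A [|[|s]]// w c0 w_inj wE.
suff : w ord0 = w ord_max by move/w_inj.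
apply: funext => j; apply/eqP; rewrite -subr_eq0.
pose dw t := w ord0 t - w ord_max t.
have dp i : p i (w ord0) - p i (w ord_max) = \sum_t b i t * dw t.
  under [RHS]eq_bigr do rewrite mulrBr.
  by rewrite sumrB /p opprD addrACA subrr addr0.
have dE t : dw t = - c * \sum_(i in A) (\sum_u b i u * dw u) * b i t.
  have := wE ord0 t; have := wE ord_max t; rewrite !mul1r !expr1 => e1 e0.
  have -> : dw t = c * (\sum_(i in A) (p i (w ord_max) - ev i) * b i t -
                        \sum_(i in A) (p i (w ord0) - ev i) * b i t).
    by rewrite /dw mulrBr; lra.
  have -> : \sum_(i in A) (p i (w ord0) - ev i) * b i t =
      \sum_(i in A) (p i (w ord_max) - ev i) * b i t +
      \sum_(i in A) (\sum_u b i u * dw u) * b i t.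
    rewrite -big_split/=; apply: eq_bigr => i _; rewrite -dp.
    by rewrite -mulrDl [in RHS]addrC addrA subrK.
  by rewrite mulNr -mulrN opprD addrA subrr add0r.
have : \sum_t dw t ^+ 2 + c * \sum_(i in A) (\sum_u b i u * dw u) ^+ 2 = 0.
  have -> : \sum_(i in A) (\sum_u b i u * dw u) ^+ 2 =
      \sum_t dw t * \sum_(i in A) (\sum_u b i u * dw u) * b i t.
    under [RHS]eq_bigr do rewrite big_distrr/=.
    rewrite exchange_big/=; apply: eq_bigr => i _.
    by rewrite expr2 big_distrr/=; apply: eq_bigr => t _; rewrite mulrA mulrC.
  rewrite big_distrr/= -big_split/= big1// => t _.
  by rewrite expr2 {2}dE mulrCA mulNr addNr.
move/eqP; rewrite paddr_eq0; last 2 first.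
- by apply: sumr_ge0 => t _; exact: sqr_ge0.
- by rewrite mulr_ge0// sumr_ge0// => i _; exact: sqr_ge0.
move=> /andP[+ _]; rewrite psumr_eq0; last by move=> t _; exact: sqr_ge0.
by move=> /allP/(_ j); rewrite mem_index_enum => /(_ isT); rewrite sqrf_eq0.
Qed.

(** For [k = D] the equations express w_j^(2D+1) as a polynomial of degree at most 2D in w, so
    [card_points_leq] applies with E = 2D+1. *)
Lemma card_sign_patterns_poly (R : realType) (T I Q : finType) (D : nat)
    (p : I -> (T -> R) -> R) (x : Q -> T -> R) :
  (forall i, polyfun D (p i)) ->
  (forall a b, (forall i, (0 < p i (x a)) = (0 < p i (x b))) -> a = b) ->
  (#|Q| <= D.*2.+1 ^ #|T| * \sum_(j < #|T|.+1) 'C(#|I|, j))%N.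
Proof.
move=> pp x_inj.
pose dp i j := s2val (cid2 (polyfun_derive j (pp i))).
have dpp i j : polyfun D.-1 (dp i j) := s2valP (cid2 (polyfun_derive j (pp i))).
have dpE i j y s : is_derive s (1 : R) (fun s => p i (shift_coord y j s))
    (dp i j (shift_coord y j s)).
  exact: (s2valP' (cid2 (polyfun_derive j (pp i)))).
apply: (@card_sign_patterns R T I Q D D _ p dp x pp dpE _ x_inj).
move=> ev c A s w c0 w_inj wE.
apply: (@card_points_leq R T D.*2.+1 s w) w_inj _ => // j.
exists (fun y => - c / D.+1%:R * \sum_(i in A) (p i y - ev i) * dp i j y).
  apply/polyfunZ/polyfun_sum => i _.
  apply: (@polyfun_leq _ _ (D + D.-1)); first by rewrite -addnn leq_add2l leq_pred.
  by apply: polyfunM => //; apply: polyfunD => //; exact: polyfun_cst.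
move=> a; apply: (@mulfI _ (D.+1%:R : R)); first by rewrite pnatr_eq0.
move/eqP: (wE a j); rewrite addr_eq0 => /eqP ->.
by rewrite mulrA mulrCA divff ?pnatr_eq0// mulr1 mulNr.
Qed.

(** * Numerical estimates *)

(** With y = n/m <= 1, y^n sum_(j <= n) C(m, j) <= sum_j C(m, j) y^j = (1+y)^m <= e^(my) = e^n. *)
Lemma sum_binomial_le (R : realType) (n m : nat) : (0 < n)%N -> (n <= m)%N ->
  (\sum_(j < n.+1) 'C(m, j))%N%:R <= (expR 1 * m%:R / n%:R) ^+ n :> R.
Proof.
move=> n0 nm.
have m0 : (0 : R) < m%:R by rewrite ltr0n (leq_trans n0).
have n0' : (0 : R) < n%:R by rewrite ltr0n.
pose y : R := n%:R / m%:R.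
have y0 : 0 < y by rewrite divr_gt0.
have y1 : y <= 1 by rewrite ler_pdivrMr// mul1r ler_nat.
rewrite (_ : _ / _ = expR 1 / y); last by rewrite /y invf_div mulrA.
rewrite expr_div_n ler_pdivlMr ?exprn_gt0// -expRM_natl mulr1.
apply: (@le_trans _ _ ((1 + y) ^+ m)); last first.
  rewrite (_ : n%:R = m%:R * y); last by rewrite mulrCA divff ?mulr1// lt0r_neq0.
  rewrite expRM_natl lerXn2r ?nnegrE ?expR_ge0 ?expR_ge1Dx//.
  by rewrite addr_ge0// ltW.
rewrite exprDn natr_sum big_distrl/= (big_ord_widen m.+1
  (fun j => 'C(m, j)%:R * y ^+ n)) ?ltnS// big_mkcond/=.
apply: ler_sum => j _; rewrite expr1n mul1r -[leRHS]mulr_natl.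
case: ifP => [jn|_]; last by rewrite mulr_ge0 ?ler0n// exprn_ge0// ltW.
by rewrite ler_wpM2l ?ler0n// ler_wiXn2l// ltW.
Qed.

Lemma ln_le_tangent (R : realType) (x y : R) : 0 < x -> 0 < y ->
  ln x <= ln y + (x / y - 1).
Proof.
move=> x0 y0; rewrite -lerBlDl -ln_div ?posrE//.
by have := @le_ln1Dx R (x / y - 1); rewrite addrCA subrr addr0; apply;
  rewrite ltrBrDr addrC subrr divr_gt0.
Qed.

Lemma ln2_ge_half (R : realType) : 2^-1 <= ln 2 :> R.
Proof.
have := @ln_le_tangent R 1 2 ltr01 (ltr0Sn R 1); rewrite ln1; lra.
Qed.

Lemma log2_ge2 (R : realType) (x : R) : 4 <= x -> 2 <= log2 x.
Proof.
move=> x4; rewrite /log2 ler_pdivlMr; last by have := ln2_ge_half R; lra.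
rewrite (_ : 2 * ln 2 = ln 4); first by rewrite ler_ln ?posrE//; lra.
rewrite (_ : 4 = 2 * 2 :> R); last by ring.
by rewrite lnM ?posrE//; ring.
Qed.

(** The right-hand side x satisfies x rho <= 2^x. If z > x, then (z-x) ln 2 <= ln z - ln x <=
    (z-x)/x, which contradicts x ln 2 > 1. *)
Lemma log2_solve (R : realType) (z rho : R) : 0 < z -> 4 <= rho ->
  z * ln 2 <= ln (z * rho) -> z <= log2 (2 * rho * log2 rho).
Proof.
move=> z0 rho4 zle; have l2 := ln2_ge_half R; have log2r := log2_ge2 rho4.
have rho0 : 0 < rho by lra.
set L := log2 rho in log2r *; set y := 2 * rho * L.
have lnE (u : R) : ln u = log2 u * ln 2.
  by rewrite /log2 divfK//; apply: lt0r_neq0; lra.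
(* Tangent of ln at 4, where equality holds. *)
have Lrho : 2 * L <= rho.
  rewrite /L /log2 mulrA ler_pdivrMr; last by lra.
  have := @ln_le_tangent R rho 4 rho0 ltac:(lra).
  have -> : ln (4 : R) = 2 * ln 2.
    rewrite (_ : 4 = 2 * 2 :> R); last by ring.
    by rewrite lnM ?posrE//; ring.
  nra.
have y0 : 0 < y by rewrite /y; nra.
set x := log2 y.
have xE : x * ln 2 = ln 2 + ln rho + ln L.
  have L0 : 0 < L by lra.
  have rho20 : 0 < 2 * rho by lra.
  by rewrite -lnE /y lnM ?posrE// lnM ?posrE.
have x2 : 2 <= x by apply: log2_ge2; rewrite /y; nra.
have xL : x <= 2 * L.
  have : ln (2 * L) <= ln rho by rewrite ler_ln ?posrE//; lra.
  rewrite lnM ?posrE//; last by lra.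
  move: xE; rewrite (lnE rho) -/L => xE h.
  rewrite -(@ler_pM2r _ (ln 2)); last by lra.
  lra.
(* Here x rho <= 2 L rho = y = 2^x. *)
have xok : ln (x * rho) <= x * ln 2.
  rewrite xE lnM ?posrE//; last by lra.
  have : ln x <= ln (2 * L) by rewrite ler_ln ?posrE//; lra.
  by rewrite lnM ?posrE//; lra.
rewrite leNgt; apply/negP => zz.
have := @ln_le_tangent R z x z0 ltac:(lra).
have e : ln (z * rho) = ln z + ln rho by rewrite lnM.
have e0 : ln (x * rho) = ln x + ln rho by rewrite lnM// posrE; lra.
have -> : z / x - 1 = (z - x) / x.
  by rewrite mulrBl divff//; apply: lt0r_neq0; lra.
rewrite -lerBlDl ler_pdivlMr; last by lra.
have xl : 1 < x * ln 2.
  have : 0 <= ln L by apply: ln_ge0; lra.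
  have : 2 * ln 2 <= ln rho by rewrite (lnE rho) -/L ler_pM2r; lra.
  rewrite xE; lra.
have dz : (z - x) * ln 2 <= ln z - ln x by rewrite mulrBl; lra.
have dzx : (z - x) * ln 2 * x <= (ln z - ln x) * x by rewrite ler_wpM2r//; lra.
have : 0 < (z - x) * (x * ln 2 - 1) by rewrite mulr_gt0// subr_gt0.
have -> : (z - x) * (x * ln 2 - 1) = (z - x) * ln 2 * x - (z - x) by ring.
set P := (z - x) * ln 2 * x in dzx *; set Q := (ln z - ln x) * x in dzx *; lra.
Qed.

(** Put W = u+n, z = m/W and rho = 2eU. Since u x1 + n x2 = em(s+b) <= m rho = W z rho, the tangent
    of ln at z rho gives u ln x1 + n ln x2 <= W ln (z rho), and [log2_solve] applies to z. *)
Lemma vc_dimension_arith (R : realType) (m u n s b : nat) (U : R) :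
  (0 < u)%N -> (0 < n)%N -> (0 < s)%N -> (0 < b)%N -> 1 <= U ->
  (s + b)%:R <= 2 * U ->
  (2 ^ m <= (\sum_(j < u.+1) 'C(m * s, j)) *
            (b ^ n * \sum_(j < n.+1) 'C(m, j)))%N ->
  m%:R <= 2 + (u + n)%:R * log2 (4 * expR 1 * U * log2 (2 * expR 1 * U)).
Proof.
move=> u0 n0 s0 b0 U1 sbU mle.
have e2 : 2 <= expR 1 :> R by have := @expR_ge1Dx R 1; lra.
pose rho := 2 * expR 1 * U.
have rho4 : 4 <= rho.
  have : 2 * 1 <= expR 1 * U by rewrite ler_pM//; lra.
  by rewrite /rho -mulrA; lra.
have -> : 4 * expR 1 * U = 2 * rho by rewrite /rho; ring.
rewrite -/rho.
have W0 : (0 : R) < (u + n)%:R by rewrite ltr0n addn_gt0 u0.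
(* For few points it suffices that the logarithm is at least 2. Otherwise n <= m and u <= ms, as
   [sum_binomial_le] requires. *)
have [mW|Wm] := leqP m (u + n).
  have : 2 <= log2 (2 * rho * log2 rho).
    have : 4 * 2 <= rho * log2 rho by rewrite ler_pM//; exact: log2_ge2.
    by move=> rholog; apply: log2_ge2; rewrite -mulrA; lra.
  set L := log2 _ => L2.
  have : (u + n)%:R * 1 <= (u + n)%:R * L by rewrite ler_wpM2l ?ltW//; lra.
  have : m%:R <= (u + n)%:R :> R by rewrite ler_nat.
  lra.
have m0 : (0 : R) < m%:R by rewrite ltr0n (leq_ltn_trans _ Wm).
have um : (u <= m * s)%N by rewrite (leq_trans _ (leq_pmulr _ s0))//; lia.
have nm : (n <= m)%N by lia.
have u0' : (0 : R) < u%:R by rewrite ltr0n.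
have n0' : (0 : R) < n%:R by rewrite ltr0n.
have s0' : (0 : R) < s%:R by rewrite ltr0n.
have b0' : (0 : R) < b%:R by rewrite ltr0n.
pose x1 : R := expR 1 * (m * s)%:R / u%:R.
pose x2 : R := b%:R * (expR 1 * m%:R / n%:R).
have x10 : 0 < x1 by rewrite divr_gt0// mulr_gt0 ?expR_gt0// natrM mulr_gt0.
have x20 : 0 < x2 by rewrite mulr_gt0// divr_gt0// mulr_gt0// expR_gt0.
have mle' : 2 ^+ m <= x1 ^+ u * x2 ^+ n.
  rewrite -natrX; apply: (@le_trans _ _ (_%:R)); first by rewrite ler_nat; exact: mle.
  rewrite natrM ler_pM ?ler0n ?sum_binomial_le//.
  by rewrite exprMn natrM natrX ler_wpM2l ?exprn_ge0// sum_binomial_le.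
have lnle : m%:R * ln 2 <= u%:R * ln x1 + n%:R * ln x2.
  have : ln (2 ^+ m) <= ln (x1 ^+ u * x2 ^+ n).
    by rewrite ler_ln ?posrE ?mulr_gt0 ?exprn_gt0.
  by rewrite lnM ?posrE ?exprn_gt0// !lnXn// !mulr_natl.
pose W : R := (u + n)%:R; pose z := m%:R / W.
have z0 : 0 < z by rewrite divr_gt0.
have zr0 : 0 < z * rho by rewrite mulr_gt0//; lra.
have zW : z * W = m%:R by rewrite divfK// lt0r_neq0.
have zle : z <= log2 (2 * rho * log2 rho).
  apply: log2_solve => //.
  rewrite -(ler_pM2l W0) mulrA [_ * z]mulrC zW; apply: le_trans lnle _.
  have t1 := ln_le_tangent x10 zr0; have t2 := ln_le_tangent x20 zr0.
  have {}t1 : u%:R * ln x1 <= u%:R * ln (z * rho) + (u%:R * x1 / (z * rho) - u%:R).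
    rewrite -(ler_pM2l u0') in t1; apply: le_trans t1 _.
    by rewrite le_eqVlt; apply/orP; left; apply/eqP; ring.
  have {}t2 : n%:R * ln x2 <= n%:R * ln (z * rho) + (n%:R * x2 / (z * rho) - n%:R).
    rewrite -(ler_pM2l n0') in t2; apply: le_trans t2 _.
    by rewrite le_eqVlt; apply/orP; left; apply/eqP; ring.
  have xs : u%:R * x1 + n%:R * x2 = expR 1 * m%:R * (s + b)%:R.
    have -> : u%:R * x1 = expR 1 * (m * s)%:R by rewrite mulrC divfK// lt0r_neq0.
    have -> : n%:R * x2 = b%:R * (expR 1 * m%:R).
      by rewrite mulrC -mulrA divfK// lt0r_neq0.
    by rewrite natrM natrD; ring.
  have xs' : (u%:R * x1) / (z * rho) + (n%:R * x2) / (z * rho) <= W.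
    rewrite -mulrDl ler_pdivrMr// xs mulrA [W * z]mulrC zW /rho.
    rewrite [leRHS](_ : _ = expR 1 * m%:R * (2 * U)); last by ring.
    by rewrite ler_wpM2l// mulr_ge0 ?expR_ge0 ?ler0n.
  have WE : W = u%:R + n%:R by rewrite /W natrD.
  have -> : (u + n)%:R * ln (z * rho) = u%:R * ln (z * rho) + n%:R * ln (z * rho).
    by rewrite natrD mulrDl.
  lra.
rewrite -zW -/W mulrC; have := ler_wpM2l (ltW W0) zle; rewrite -/W; lra.
Qed.

(** * Ridge splines *)

Lemma meval_degree_each_le (R : realType) (l r : nat) (p : mpoly.mpoly l R) :
  degree_each_le r p -> exists c : {ffun 'I_l -> 'I_r.+1} -> R,
    forall v, mpoly.meval v p = \sum_e c e * \prod_j v j ^+ e j.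
Proof.
move=> pr.
(* [inord] is faithful on the monomials with nonzero coefficient, whose exponents are at most
   [r]. *)
pose ex (m : mpoly.multinom l) : {ffun 'I_l -> 'I_r.+1} :=
  [ffun j => inord (mpoly.fun_of_multinom m j)].
exists (fun e => \sum_(m <- mpoly.msupp p | ex m == e) mpoly.mcoeff m p) => v.
rewrite mpoly.mevalE (partition_big ex predT)//=; apply: eq_bigr => e _.
rewrite big_distrl/=; apply: eq_bigr => m /eqP <-.
have [->|pm] := eqVneq (mpoly.mcoeff m p) 0; first by rewrite !mul0r.
congr (_ * _); apply: eq_bigr => j _; rewrite ffunE inordK// ltnS.
exact: pr.
Qed.

(** The index is the least h with u <= (h+1)/t; minimality gives h/t < u when h > 0. *)
Lemma cell_interval_exists (R : realType) (t : nat) (u : R) :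
  (0 < t)%N -> 0 <= u <= 1 -> exists h : 'I_t, cell_interval R t h u.
Proof.
move=> t0 /andP[u0 u1]; have t0' : (0 : R) < t%:R by rewrite ltr0n.
have ex_h : exists h, u <= h.+1%:R / t%:R.
  by exists t.-1; rewrite prednK// divff// lt0r_neq0.
case: (ex_minnP ex_h) => h uh hmin.
have ht : (h < t)%N.
  apply: (@leq_ltn_trans t.-1); last by rewrite prednK.
  by apply: hmin; rewrite prednK// divff// lt0r_neq0.
exists (Ordinal ht); rewrite /cell_interval/=.
case: eqVneq uh hmin => [->|h0] uh hmin /=.
  by rewrite in_itv/= u0 -[_^-1]mul1r.
rewrite in_itv/= uh andbT ltNge; apply/negP => uh'.
have := hmin h.-1; rewrite prednK ?lt0n// => /(_ uh').
by rewrite leqNgt prednK ?lt0n// leqnn.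
Qed.

(** Cells contain their right end but, except at 0, not their left end, so the comparisons k/t < u
    decide the cell. The last right end is 1, covered by v <= 1. *)
Lemma cell_interval_same (R : realType) (t : nat) (h : 'I_t) (u v : R) :
  0 <= v <= 1 ->
  (forall k : 'I_t, (k%:R / t%:R < u) = (k%:R / t%:R < v)) ->
  cell_interval R t h u -> cell_interval R t h v.
Proof.
move=> /andP[v0 v1] uv.
have t0 : (0 < t)%N by apply: leq_ltn_trans (ltn_ord h).
have vle : u <= h.+1%:R / t%:R -> v <= h.+1%:R / t%:R.
  have [ht|] := ltnP h.+1 t.
    by rewrite !leNgt (uv (Ordinal ht)).
  move=> th; have -> : h.+1 = t by apply/eqP; rewrite eqn_leq th ltn_ord.
  by rewrite divff// pnatr_eq0 -lt0n.
rewrite /cell_interval; case: eqVneq vle => [->|h0] vle /=; rewrite !in_itv/=.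
  by rewrite v0 -[_^-1]mul1r => /andP[_ /vle].
by rewrite -uv => /andP[-> /vle].
Qed.

Lemma ridge_unit (R : realType) (d l : nat) (a : 'I_l -> 'rV[R]_d) x j :
  l1_ball R d (a j) -> unit_cube R d x -> 0 <= ridge a x 0 j <= 1.
Proof.
move=> aj xc; rewrite /ridge mxE.
suff : `|dotv (a j) x| <= 1 by rewrite ler_norml; lra.
rewrite /dotv; apply: le_trans (ler_norm_sum _ _ _) _; apply: le_trans aj.
apply: ler_sum => i _; rewrite normrM ler_piMr//.
by have := xc i; rewrite /= in_itv/= => /andP[x0 x1]; rewrite ger0_norm.
Qed.

(** The first factor bounds the number of patterns [pat] of comparisons with the thresholds, the
    second the number of subsets that share a pattern. *)
Lemma shattered_card_le (R : realType) (vm vp : R) (d l : nat) (r : nat)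
    (t : 'I_l -> nat) (m : nat) (xs : 'I_m -> 'rV[R]_d) (ys : 'I_m -> R) :
  (forall j, 0 < t j)%N ->
  (forall i, unit_cube R d (xs i)) ->
  (forall S : {set 'I_m}, exists2 g, GammaM vm vp d t r g &
     forall i, (i \in S) = (ys i < g (xs i))) ->
  (2 ^ m <= (\sum_(j < (l * d).+1) 'C(m * \sum_j t j, j)) *
    ((l * r).+1.*2.+1 ^ (l * d + (\prod_j t j) * r.+1 ^ l) *
     \sum_(j < (l * d + (\prod_j t j) * r.+1 ^ l).+1) 'C(m, j)))%N.
Proof.
move=> t0 xc shat; set n := (l * d + _)%N.
have [par parP] : exists par : {set 'I_m} ->
      ('I_l -> 'rV[R]_d) * ('rV[R]_l -> R),
    forall S, [/\ forall j, l1_ball R d ((par S).1 j), spline R t r (par S).2 &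
      forall i, (i \in S) =
        (ys i < Num.min (Num.max ((par S).2 (ridge (par S).1 (xs i))) vm) vp)].
  suff H (S : {set 'I_m}) : exists z : ('I_l -> 'rV[R]_d) * ('rV[R]_l -> R),
    [/\ forall j, l1_ball R d (z.1 j), spline R t r z.2 &
      forall i, (i \in S) =
        (ys i < Num.min (Num.max (z.2 (ridge z.1 (xs i))) vm) vp)].
    by exists (fun S => projT1 (cid (H S))) => S; exact: (projT2 (cid (H S))).
  have [_ [_ [gam sgam <-] [a al1 ->]] gP] := shat S.
  by exists (a, gam); split.
pose a S := (par S).1; pose gam S := (par S).2.
have al1 S j : l1_ball R d (a S j) by have [H _ _] := parP S; exact: H.
have sgam S : spline R t r (gam S) by have [_ H _] := parP S; exact: H.
(* The full trace gives y_i < v_+ and the empty one v_- <= y_i, so clipping does not affect the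
   comparison with y_i. *)
have ys_lt i : ys i < vp.
  have [_ _ /(_ i)] := parP [set: 'I_m]%SET; rewrite inE => /esym.
  by rewrite lt_min => /andP[].
have ys_ge i : vm <= ys i.
  have [_ _ /(_ i)] := parP finset.set0; rewrite inE => /esym/negbT.
  by rewrite lt_min ys_lt andbT lt_max negb_or -!leNgt => /andP[].
have inS (S : {set 'I_m}) i : (i \in S) = (ys i < gam S (ridge (a S) (xs i))).
  have [_ _ ->] := parP S.
  by rewrite lt_min ys_lt andbT lt_max [_ < vm]ltNge ys_ge orbF.
pose I1 := ('I_m * {j : 'I_l & 'I_(t j)})%type.
pose above (z : I1) S :=
  (tagged z.2)%:R / (t (tag z.2))%:R < ridge (a S) (xs z.1) 0 (tag z.2).
pose pat S : {ffun I1 -> bool} := [ffun z => above z S].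
pose T1 := ('I_l * 'I_d)%type.
have card1 : (#|codom pat| <= \sum_(j < (l * d).+1) 'C(m * \sum_j t j, j))%N.
  rewrite -card_sig.
  have -> : (l * d)%N = #|{: T1}| by rewrite card_prod !card_ord.
  have -> : (m * \sum_j t j)%N = #|{: I1}|.
    rewrite card_prod card_ord card_tagged sumnE big_map big_enum/=.
    by congr (_ * _)%N; apply: eq_bigr => j _; rewrite card_ord.
  pose ofpat (z : {z | z \in codom pat}) := iinv (valP z).
  have patK z : pat (ofpat z) = val z by rewrite /ofpat f_iinv.
  (* The affine form is g_j(x_i) - h/t_j in the coordinates of all the a_j; the Boolean factor
     selects the vector a_j. *)
  apply: (@card_sign_patterns_affine R T1 I1 _
    (fun z u => 2^-1 * ((u.1 == tag z.2)%:R * xs z.1 0 u.2))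
    (fun z => 2^-1 - (tagged z.2)%:R / (t (tag z.2))%:R)
    (fun z u => a (ofpat z) u.1 0 u.2)).
  move=> z z' zz'; apply: val_inj; rewrite -!patK; apply/ffunP => e.
  rewrite !ffunE.
  have aboveE (S : {set 'I_m}) : above e S =
    (0 < \sum_u 2^-1 * ((u.1 == tag e.2)%:R * xs e.1 0 u.2) * a S u.1 0 u.2 +
       (2^-1 - (tagged e.2)%:R / (t (tag e.2))%:R)).
    rewrite /above -[LHS]subr_gt0 mxE mulrDr mulr1 -addrA; congr (0 < _ + _).
    rewrite /dotv big_distrr/= -(pair_bigA _ (fun j k =>
      2^-1 * ((j == tag e.2)%:R * xs e.1 0 k) * a S j 0 k))/=.
    rewrite [RHS](bigD1 (tag e.2))//= eqxx [X in _ + X]big1 ?addr0.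
      by apply: eq_bigr => k _; rewrite mul1r -mulrA [_ * a _ _ _ _]mulrC.
    move=> j /negPf jne; apply: big1 => k _.
    by rewrite jne mul0r mulr0 mul0r.
  by rewrite !aboveE; exact: zz'.
have -> : (2 ^ m)%N = #|{: {set 'I_m}}|.
  by rewrite -cardsT -powersetT card_powerset cardsT card_ord.
apply: (@leq_trans (#|codom pat| * ((l * r).+1.*2.+1 ^ n * \sum_(j < n.+1) 'C(m, j)))%N);
  last by rewrite leq_mul2r card1 orbT.
apply: (@card_le_preimages _ _ pat) => [S|e]; first exact: codom_f.
have [->//|] := posnP #|[pred S | pat S == e]|.
move=> /card_gt0P[S0 /eqP S0e].
(* The cells are read off one member [S0] of the fibre; the other members make the same comparisons
   and so have the same cells. *)
have [cell cellP] : exists cell : 'I_m -> {dffun forall j : 'I_l, 'I_(t j)},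
    forall i, hyperrectangle R t (fun j => cell i j) (ridge (a S0) (xs i)).
  have H i j : exists h : 'I_(t j),
      cell_interval R (t j) h (ridge (a S0) (xs i) 0 j).
    by apply: cell_interval_exists => //; exact: ridge_unit.
  exists (fun i => [ffun j => projT1 (cid (H i j))]) => i j.
  by rewrite ffunE; exact: (projT2 (cid (H i j))).
have cell_all S : pat S = e ->
    forall i, hyperrectangle R t (fun j => cell i j) (ridge (a S) (xs i)).
  move=> Se i j; apply: cell_interval_same (cellP i j); first exact: ridge_unit.
  move=> k; have := etrans S0e (esym Se).
  move/ffunP/(_ (i, Tagged (fun j => 'I_(t j)) k)).
  by rewrite !ffunE.
pose Mon := {ffun 'I_l -> 'I_r.+1}.
pose Cell := {dffun forall j : 'I_l, 'I_(t j)}.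
have [cf cfP] : exists cf : {set 'I_m} -> Cell -> Mon -> R,
    forall S (h : Cell) x, hyperrectangle R t (fun j => h j) x ->
      gam S x = \sum_e cf S h e * \prod_j x 0 j ^+ e j.
  have H S (h : Cell) : exists c : Mon -> R, forall x,
      hyperrectangle R t (fun j => h j) x ->
      gam S x = \sum_e c e * \prod_j x 0 j ^+ e j.
    have [p pr pE] := sgam S (fun j => h j).
    have [c cE] := meval_degree_each_le pr.
    by exists c => x hx; rewrite pE// cE.
  exists (fun S h => projT1 (cid (H S h))) => S h.
  exact: (projT2 (cid (H S h))).
pose T2 := (T1 + Cell * Mon)%type.
have -> : n = #|{: T2}|.
  rewrite card_sum !card_prod !card_ord card_ffun !card_ord.
  rewrite card_dep_ffun foldrE big_image/=.
  by congr (_ + _ * _)%N; apply: eq_bigr => j _; rewrite card_ord.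
rewrite -[m in \sum_(j < _) 'C(m, j)]card_ord -card_sig.
(* The degree is at most lr+1: one coefficient times l affine forms, each to a power at most r. The
   cell of x_i is fixed, so [p i] is a single polynomial. *)
pose p (i : 'I_m) (y : T2 -> R) := \sum_(f : Mon) y (inr (cell i, f)) *
  \prod_j (2^-1 * (\sum_k xs i 0 k * y (inl (j, k)) + 1)) ^+ f j - ys i.
pose x (S : {S | pat S == e}) (u : T2) : R := match u with
  | inl (j, k) => a (val S) j 0 k
  | inr (h, f) => cf (val S) h f
  end.
apply: (@card_sign_patterns_poly R T2 'I_m _ (l * r).+1 p x).
  move=> i; apply: polyfunD; last exact: polyfun_cst.
  apply: polyfun_sum => f _; apply: polyfunXM.
  apply: (@polyfun_leq _ _ (\sum_j f j * 1)%N).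
    rewrite -[l in leqRHS]card_ord -sum_nat_const.
    by apply: leq_sum => j _; rewrite muln1 -ltnS ltn_ord.
  apply: polyfun_prod => j _; apply/polyfunXn/polyfunZ/polyfunD.
    by apply: polyfun_sum => k _; apply/polyfunZ/polyfunX.
  exact: polyfun_cst.
have pE S i : (0 < p i (x S)) = (i \in val S).
  rewrite inS /p subr_gt0; congr (_ < _).
  rewrite (cfP _ (cell i)); last by apply: cell_all; exact/eqP/(valP S).
  apply: eq_bigr => f _; congr (_ * _); apply: eq_bigr => j _.
  rewrite mxE; congr ((_ * (_ + _)) ^+ _).
  by apply: eq_bigr => k _; rewrite mulrC.
move=> S S' SS'; apply/val_inj/setP => i.
by rewrite -!pE SS'.
Qed.

(** * Existence of the VC dimension and the final bound *)

Lemma GammaM_nonempty (R : realType) (vm vp : R) (d l : nat) (t : 'I_l -> nat)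
    (r : nat) : exists g, GammaM vm vp d t r g.
Proof.
exists (fun x => Num.min (Num.max 0 vm) vp).
exists (fun x => Num.min (Num.max 0 vm) vp).
  exists (fun=> 0) => // h; exists (mpoly.mpolyC l (0 : R)).
    by move=> e; rewrite mpoly.mcoeffC mul0r eqxx.
  by move=> x _; rewrite mpoly.mevalC.
exists (fun=> 0) => // j.
by rewrite /l1_ball /= big1// => i _; rewrite mxE normr0.
Qed.

(** A nonempty [F] shatters the empty set, so the shattered cardinalities form a nonempty bounded
    set of naturals, which has a maximum. *)
Lemma VC_subgraph_dim_exists (R : realType) (T : Type) (W : set T)
    (F : set (T -> R)) (b : R) :
  (exists f, F f) ->
  (forall n (S : set (T * R)), S `<=` W `*` setT -> (S #= `I_n)%card ->
     subgraph_shatters F S -> n%:R <= b) ->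
  exists V, VC_subgraph_dim W F V /\ V%:R <= b.
Proof.
move=> [f Ff] bound.
pose P n := `[< exists S : set (T * R),
  [/\ S `<=` W `*` setT, (S #= `I_n)%card & subgraph_shatters F S] >].
have Pb n : P n -> n%:R <= b by move=> /asboolP[S [SW Sn shat]]; exact: bound shat.
have P0 : P 0%N.
  apply/asboolP; exists set0; split=> //; first by rewrite II0.
  by move=> A; rewrite subset0 => ->; exists f => //; rewrite set0I.
have Pmax n : P n -> (n <= Num.Def.archi_bound b)%N.
  move=> Pn; rewrite -(ler_nat R) (le_trans (Pb n Pn))// ltW//.
  by apply: archi_boundP; exact: Pb P0.
have [V PV Vmax] := ex_maxnP (ex_intro _ 0%N P0) Pmax.
exists V; split; last exact: Pb.
split; first exact/asboolP.
by move=> n S SW Sn shat; apply: Vmax; apply/asboolP; exists S.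
Qed.

Lemma subgraph_shatters_finite (R : realType) (T : pointedType) (W : set T)
    (F : set (T -> R)) (n : nat) (S : set (T * R)) :
  S `<=` W `*` setT -> (S #= `I_n)%card -> subgraph_shatters F S ->
  exists (xs : 'I_n -> T) (ys : 'I_n -> R), (forall i, W (xs i)) /\
    forall Q : {set 'I_n}, exists2 f, F f &
      forall i, (i \in Q) = (ys i < f (xs i)).
Proof.
move=> SW /card_esym/card_set_bijP[e [eS e_inj _]] shat.
have eSi (i : 'I_n) : S (e i) by apply: eS; exact: ltn_ord.
exists (fun i => (e i).1), (fun i => (e i).2); split=> [i|Q].
  by have [] := SW _ (eSi i).
have [|f Ff fE] := shat [set e i | i in [set i | i \in Q]].
  by move=> _ [i _ <-].
exists f => // i; apply/idP/idP => [iQ|fi].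
  have : [set (e i : T * R) | i in [set i | i \in Q]] (e i) by exists i.
  by rewrite fE => -[].
have : [set (e i : T * R) | i in [set i | i \in Q]] (e i) by rewrite fE.
move=> [j /= jQ eij]; rewrite (_ : i = j)//; apply/val_inj/esym.
by apply: e_inj eij; apply/mem_set; exact: ltn_ord.
Qed.

Unset Implicit Arguments.

Theorem proposition2 (R : realType) (vm vp : R) (hv : vm < vp)
    (d l : nat) (hd : (0 < d)%N) (hl : (0 < l)%N)
    (r : nat) (t : 'I_l -> nat) (ht : forall j, (0 < t j)%N) :
  let U : R := (\sum_(j < l) t j + l * r + l + 1)%N%:R in
  exists V : nat,
    VC_subgraph_dim (unit_cube R d) (GammaM vm vp d t r) V /\
    V%:R <= 2 + (2 * l * d + (\prod_(j < l) t j) * (r + 1) ^ l)%N%:R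
                * log2 (4 * expR 1 * U * log2 (2 * expR 1 * U)).
Proof.
move=> U; apply: VC_subgraph_dim_exists; first exact: GammaM_nonempty.
move=> m S SW Sm /(subgraph_shatters_finite SW Sm)[xs [ys [xc shat]]].
have := shattered_card_le ht xc shat.
set n := (l * d + _)%N; set s := (\sum_j t j)%N => mle.
have ld0 : (0 < l * d)%N by rewrite muln_gt0 hl.
have s0 : (0 < s)%N.
  by rewrite /s (bigD1 (Ordinal hl))//= addn_gt0 ht.
(* The ld coordinates of the a_j are counted once in each of the two factors. *)
have -> : (2 * l * d + \prod_(j < l) t j * (r + 1) ^ l = l * d + n)%N.
  by rewrite /n addn1 addnA addnn -mul2n mulnA.
apply: vc_dimension_arith mle => //.
- by rewrite /n addn_gt0 ld0.
- by rewrite ler1n addn1.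
(* Here s + b = s + 2lr + 3, while 2U = 2s + 2lr + 2l + 2. *)
- by rewrite -natrM ler_nat -/s; lia.
Qed.
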